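(* Let $\Gamma$ and $\Lambda$ be countable, locally finite groups with proper left-invariant metrics $d_\Gamma$ and $d_\Lambda$ respectively. Then the following conditions are equivalent: \begin{enumerate} \item[(1)] $(\Gamma,d_\Gamma)$ and $(\Lambda,d_\Lambda)$ are bijectively coarsely equivalent. \item[(2)] For every $p\in[1,\infty)$, there is an isometric isomorphism $\phi:B^p_u(\Gamma)\rightarrow B^p_u(\Lambda)$ such that $\phi(\ell^\infty(\Gamma))=\ell^\infty(\Lambda)$. \item[(3)] $B^p_u(\Gamma)$ and $B^p_u(\Lambda)$ are isometrically isomorphic for some $p\in[1,\infty)$. \item[(4)] $(K_0(B^p_u(\Gamma)),K_0(B^p_u(\Gamma))^+,[1]_0)\cong(K_0(B^p_u(\Lambda)),K_0(B^p_u(\Lambda))^+,[1]_0)$ for every $p\in[1,\infty)$. \item[(5)] $(K_0(B^p_u(\Gamma)),[1]_0)\cong(K_0(B^p_u(\Lambda)),[1]_0)$ for some $p\in[1,\infty)$. \end{enumerate}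
   Context: A discrete group is locally finite if every finitely generated subgroup is finite. A countable group with a proper (balls are finite) left-invariant metric is a metric space with bounded geometry, i.e. for any $R>0$ the closed $R$-balls have uniformly bounded cardinality. For a bounded geometry metric space $(X,d)$ and $T\in B(\ell^p(X))$ write $T_{xy}=(T\delta_y)(x)$ and $\mathrm{prop}(T)=\sup\{d(x,y):x,y\in X,\ T_{xy}\neq 0\}\in[0,\infty]$. The $\ell^p$ uniform Roe algebra $B^p_u(X)$ is the operator norm closure in $B(\ell^p(X))$ of the algebra of all bounded operators on $\ell^p(X)$ with finite propagation. $\ell^\infty(X)$ is viewed as the subalgebra of $B^p_u(X)$ consisting of multiplication (diagonal) operators. Isometric isomorphisms are isometric isomorphisms of Banach algebras. $K_0(A)^+$ denotes the set of classes in $K_0(A)$ of idempotents in matrix algebras over the unital Banach algebra $A$, and $[1]_0$ the class of the unit. An isomorphism of triples $(K_0,K_0^+,[1]_0)$ is a group isomorphism carrying the positive cone onto the positive cone and $[1]_0$ to $[1]_0$; an isomorphism of pairs $(K_0,[1]_0)$ is a group isomorphism carrying $[1]_0$ to $[1]_0$. A (not necessarily continuous) map $f:X\to Y$ of metric spaces is uniformly expansive if for all $R>0$ there exists $S>0$ such that $d(x_1,x_2)\le R$ implies $d(f(x_1),f(x_2))\le S$. Two maps are close if they are at uniformly bounded distance from each other. A uniformly expansive map $f:X\to Y$ is a coarse equivalence if there is a uniformly expansive $g:Y\to X$ such that $f\circ g$ and $g\circ f$ are close to the respective identity maps. A bijective coarse equivalence is a coarse equivalence that is a bijection; $X$ and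 $Y$ are bijectively coarsely equivalent if such a map exists. *)

(* Defs.v *)
From HB Require Import structures.
From mathcomp Require Import all_boot all_order all_algebra.
From mathcomp Require Import ssrAC generic_quotient complex.
From mathcomp Require Import all_classical all_reals all_analysis.
Set Implicit Arguments.
Unset Strict Implicit.
Unset Printing Implicit Defensive.
Import Order.TTheory GRing.Theory Num.Theory Normc.
Local Open Scope classical_set_scope.
Local Open Scope ring_scope.

Record exponent (R : realType) := Exponent {
  exponent_val :> R;
  exponent_ge1 : 1 <= exponent_val }.

Section Lp.
Context {R : realType} (p : exponent R) (X : choiceType).
Implicit Types f g : X -> R[i].

(* The p-th power of the l^p norm; it is +oo outside of l^p(X). *)
Definition lp_pow f : \bar R := \esum_(x in [set: X]) (normc (f x) `^ p)%:E.

Definition lp_pred : {pred X -> R[i]} := fun f => `[< (lp_pow f < +oo)%E >].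

Lemma exponent_gt0 : 0 < p :> R.
Proof. exact: lt_le_trans (exponent_ge1 p). Qed.

Lemma exponent_neq0 : (p : R) != 0.
Proof. by rewrite gt_eqF// exponent_gt0. Qed.

Lemma normc_ge0 (z : R[i]) : 0 <= normc z.
Proof. by case: z => a b; exact: sqrtr_ge0. Qed.

Lemma normcR (c : R) : 0 <= c -> normc c%:C%C = c.
Proof. by move=> c0; rewrite /= expr0n/= addr0 sqrtr_sqr ger0_norm. Qed.

Lemma lp_pow_ge0 f : (0 <= lp_pow f)%E.
Proof. by apply: esum_ge0 => x _; rewrite lee_fin powR_ge0. Qed.

Lemma powR_convex (t a b : R) : 0 <= t <= 1 -> 0 <= a -> 0 <= b ->
  (t * a + (1 - t) * b) `^ p <= t * a `^ p + (1 - t) * b `^ p.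
Proof.
move=> /andP[t0 t1] a0 b0.
have /= := @convex_powR R _ (exponent_ge1 p) (Itv01 t0 t1) a b.
by rewrite !convRE/= /unstable.onem; apply; rewrite inE/= in_itv/= andbT.
Qed.

Lemma lp_powZ (c : R[i]) f :
  lp_pow (fun x => (c * f x)%R) = ((normc c `^ p)%:E * lp_pow f)%E.
Proof.
rewrite /lp_pow /esum -ereal_supZl ?powR_ge0//; last first.
  by apply/set0P; exists 0%E => /=; exists set0; [exact: fsets_set0|rewrite fsbig_set0].
congr ereal_sup; rewrite image_comp; apply: eq_imagel => A [finA _] /=.
rewrite !fsumEFin// -EFinM mulr_fsumr; congr (_%:E).
by apply: eq_fsbigr => x _; rewrite normcM powRM ?normc_ge0.
Qed.

Lemma lp_pow_convex (t a b : R) f g : 0 <= t <= 1 -> 0 <= a -> 0 <= b ->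
  (lp_pow (fun x => ((t * a)%:C%C * f x + ((1 - t) * b)%:C%C * g x)%R)
   <= (t * a `^ p)%:E * lp_pow f + ((1 - t) * b `^ p)%:E * lp_pow g)%E.
Proof.
move=> /andP[t0 t1] a0 b0; have u0 : 0 <= 1 - t by rewrite subr_ge0.
have esumZ (c : R) h : 0 <= c ->
    (c%:E * lp_pow h)%E = \esum_(x in [set: X]) (c * normc (h x) `^ p)%:E.
  move=> c0; rewrite /lp_pow /esum -ereal_supZl//; last first.
    by apply/set0P; exists 0%E => /=; exists set0; [exact: fsets_set0|rewrite fsbig_set0].
  congr ereal_sup; rewrite image_comp; apply: eq_imagel => A [finA _] /=.
  by rewrite !fsumEFin// -EFinM mulr_fsumr.
rewrite !esumZ ?mulr_ge0 ?powR_ge0// -esumD; try by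
  move=> x _; rewrite lee_fin !mulr_ge0 ?powR_ge0.
apply: le_esum => x _; rewrite -EFinD lee_fin -!mulrA -!powRM ?normc_ge0//.
apply: le_trans (powR_convex _ _ _); rewrite ?mulr_ge0 ?normc_ge0 ?t0//.
apply: ge0_ler_powR; rewrite ?nnegrE ?addr_ge0 ?mulr_ge0 ?normc_ge0//.
  exact: ltW exponent_gt0.
apply: le_trans (le_normcD _ _) _.
by rewrite !normcM !normcR// ?mulr_ge0// !mulrA.
Qed.

Lemma lp_pred_subsemimod : GRing.subsemimod_closed lp_pred.
Proof.
split; [split|].
- apply/asboolP; rewrite /lp_pow esum1// => x _.
  by rewrite normc0 powR0// exponent_neq0.
- move=> f g /asboolP ff /asboolP gf; apply/asboolP.
  have h01 : 0 <= (2^-1 : R) <= 1 by rewrite invr_ge0 ler0n invf_le1// ler1n.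
  have := lp_pow_convex f g h01 (ler0n R 2) (ler0n R 2).
  have -> : 1 - 2^-1 = 2^-1 :> R by rewrite [X in X - _](splitr 1) div1r addrK.
  rewrite mulVf// => /le_lt_trans; rewrite (_ : (fun x => _) = f + g); last first.
    by apply/funext => x; rewrite !mul1r.
  apply; apply: lte_add_pinfty; rewrite lte_mul_pinfty// ?lee_fin ?mulr_ge0 ?powR_ge0//.
- move=> c f /asboolP ff; apply/asboolP.
  have -> : c *: f = (fun x => c * f x) by [].
  by rewrite lp_powZ lte_mul_pinfty// lee_fin powR_ge0.
Qed.
End Lp.

Record lp (R : realType) (p : exponent R) (X : choiceType) := Lp {
  lp_val :> X -> R[i];
  lp_valP : lp_val \in @lp_pred R p X }.

Section LpType.
Context {R : realType} (p : exponent R) (X : choiceType).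

HB.instance Definition _ := [isSub for @lp_val R p X].
HB.instance Definition _ := [Choice of lp p X by <:].
HB.instance Definition _ := GRing.SubChoice_isSubLmodule.Build _ _ _ (lp p X)
  (@lp_pred_subsemimod R p X).

Definition lpnorm (f : lp p X) : R := fine (lp_pow p f) `^ (p : R)^-1.

Implicit Types f g : lp p X.

Lemma lp_ext f g : f =1 g -> f = g.
Proof. by move=> fg; apply/val_inj/funext. Qed.

Lemma lp0E x : (0 : lp p X) x = 0. Proof. by []. Qed.
Lemma lpDE f g x : (f + g) x = f x + g x. Proof. by []. Qed.
Lemma lpNE f x : (- f) x = - f x. Proof. by []. Qed.
Lemma lpZE c f x : (c *: f) x = c * f x. Proof. by []. Qed.

Lemma lpnorm_ge0 f : 0 <= lpnorm f.
Proof. exact: powR_ge0. Qed.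

Lemma lp_powE f : lp_pow p f = (lpnorm f `^ p)%:E.
Proof.
rewrite /lpnorm -powRrM mulVf ?exponent_neq0// powRr1 ?fine_ge0 ?lp_pow_ge0//.
rewrite fineK// ge0_fin_numE ?lp_pow_ge0//.
by have /asboolP := lp_valP f.
Qed.

Lemma lpnorm_le f (M : R) : 0 <= M -> (lp_pow p f <= (M `^ p)%:E)%E ->
  lpnorm f <= M.
Proof.
move=> M0; rewrite lp_powE lee_fin => h.
rewrite leNgt; apply/negP => Mf; move: h; rewrite leNgt => /negP; apply.
by apply: gt0_ltr_powR; rewrite ?nnegrE ?lpnorm_ge0 ?exponent_gt0.
Qed.

Lemma lpnormZ c f : lpnorm (c *: f) = normc c * lpnorm f.
Proof.
rewrite /lpnorm (_ : lp_pow p (c *: f) = lp_pow p (fun x => c * f x))//.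
rewrite lp_powZ lp_powE /= powRM ?powR_ge0// -!powRrM mulfV ?exponent_neq0//.
by rewrite powRr1 ?normc_ge0// powRr1 ?lpnorm_ge0.
Qed.

Lemma normc_le_lpnorm f x : normc (f x) <= lpnorm f.
Proof.
have : ((normc (f x) `^ p)%:E <= lp_pow p f)%E.
  apply: esum_ge; exists [set x]; first by split.
  by rewrite fsbig_set1.
rewrite lp_powE lee_fin => h.
rewrite leNgt; apply/negP => Mf; move: h; rewrite leNgt => /negP; apply.
by apply: gt0_ltr_powR; rewrite ?nnegrE ?lpnorm_ge0 ?normc_ge0 ?exponent_gt0.
Qed.

Lemma lpnorm0_eq0 f : lpnorm f = 0 -> f = 0.
Proof.
move=> f0; apply: lp_ext => x; apply/eq0_normc/le_anti.
by rewrite normc_ge0 andbT -f0 normc_le_lpnorm.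
Qed.

Lemma lpnorm0 : lpnorm 0 = 0.
Proof. by rewrite -(scale0r 0) lpnormZ normc0 mul0r. Qed.

Lemma lpnormN f : lpnorm (- f) = lpnorm f.
Proof. by rewrite -scaleN1r lpnormZ normcN normc1 mul1r. Qed.

Lemma lp_pow_add (a b : R) f g : 0 < a -> 0 < b ->
  lp_pow p f = (a `^ p)%:E -> lp_pow p g = (b `^ p)%:E ->
  (lp_pow p (lp_val (f + g)%R) <= ((a + b) `^ p)%:E)%E.
Proof.
move=> a0 b0 fa gb; have s0 : 0 < a + b := addr_gt0 a0 b0.
have t01 : 0 <= a / (a + b) <= 1.
  by rewrite (divr_ge0 (ltW a0) (ltW s0))/= (ler_pdivrMr _ _ s0) mul1r lerDl (ltW b0).
have := lp_pow_convex p f g t01 (ltW (divr_gt0 s0 a0)) (ltW (divr_gt0 s0 b0)).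
have -> : 1 - a / (a + b) = b / (a + b).
  by rewrite -[X in X - _](@divff _ (a + b)) ?(gt_eqF s0)// -mulrBl addrAC subrr add0r.
have cancel1 (c : R) : 0 < c -> c / (a + b) * ((a + b) / c) = 1.
  by move=> c0; rewrite mulrA divfK ?(gt_eqF s0)// divff ?(gt_eqF c0).
rewrite (cancel1 _ a0) (cancel1 _ b0).
have <- : lp_val (f + g) = (fun x => 1%:C%C * f x + 1%:C%C * g x).
  by apply/funext => x; rewrite !mul1r.
move/le_trans; apply; rewrite fa gb -!EFinM -EFinD lee_fin.
have powc (c : R) : 0 < c -> ((a + b) / c) `^ p * c `^ p = (a + b) `^ p.
  move=> c0; rewrite -powRM ?(ltW c0) ?(divr_ge0 (ltW s0) (ltW c0))//.
  by rewrite divfK ?(gt_eqF c0).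
rewrite -!mulrA (powc _ a0) (powc _ b0) !mulrA -!mulrDl.
by rewrite divff ?(gt_eqF s0)// mul1r.
Qed.

Lemma lpnormD f g : lpnorm (f + g) <= lpnorm f + lpnorm g.
Proof.
have [/lpnorm0_eq0 ->|a0] := eqVneq (lpnorm f) 0; first by rewrite add0r ler_wpDl// lpnorm_ge0.
have [/lpnorm0_eq0 ->|b0] := eqVneq (lpnorm g) 0; first by rewrite addr0 ler_wpDr// lpnorm_ge0.
have {}a0 : 0 < lpnorm f by rewrite lt_def a0 lpnorm_ge0.
have {}b0 : 0 < lpnorm g by rewrite lt_def b0 lpnorm_ge0.
apply: lpnorm_le; first exact: addr_ge0 (ltW a0) (ltW b0).
exact: lp_pow_add a0 b0 (lp_powE f) (lp_powE g).
Qed.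
End LpType.

Section BoundedOperators.
Context {R : realType} (p : exponent R) (X : choiceType).

Definition bop_pred : {pred lp p X -> lp p X} := fun T =>
  `[< linear T /\ exists M, forall f, lpnorm (T f) <= M * lpnorm f >].

Lemma bop_pred_subsemimod : GRing.subsemimod_closed bop_pred.
Proof.
split; [split|].
- apply/asboolP; split=> [c f g|]; first by rewrite /= scaler0 addr0.
  by exists 0 => f; rewrite mul0r lpnorm0.
- move=> S T /asboolP[Sl [M SM]] /asboolP[Tl [N TN]]; apply/asboolP; split.
    move=> c f g; have STE h : (S + T) h = S h + T h by [].
    by rewrite !STE Sl Tl scalerDr addrACA.
  exists (M + N) => f; apply: le_trans (lpnormD _ _) _.
  by rewrite mulrDl lerD.
- move=> c T /asboolP[Tl [M TM]]; apply/asboolP; split.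
    move=> d f g; have cTE h : (c *: T) h = c *: T h by [].
    by rewrite !cTE Tl scalerDr !scalerA mulrC.
  by exists (normc c * M) => f; rewrite lpnormZ -mulrA ler_wpM2l ?normc_ge0.
Qed.
End BoundedOperators.

Record bop (R : realType) (p : exponent R) (X : choiceType) := Bop {
  bop_fun :> lp p X -> lp p X;
  bop_funP : bop_fun \in @bop_pred R p X }.

Section BopRing.
Context {R : realType} (p : exponent R) (X : choiceType).
Implicit Types (S T U : bop p X) (f g : lp p X).

HB.instance Definition _ := [isSub for @bop_fun R p X].
HB.instance Definition _ := [Choice of bop p X by <:].
HB.instance Definition _ := GRing.SubChoice_isSubLmodule.Build _ _ _ (bop p X)
  (@bop_pred_subsemimod R p X).

Lemma bop_ext S T : S =1 T -> S = T.
Proof. by move=> ST; apply/val_inj/funext. Qed.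

Lemma bop_linear T : linear T.
Proof. by have /asboolP[] := bop_funP T. Qed.

Lemma bop_bounded T : exists M, forall f, lpnorm (T f) <= M * lpnorm f.
Proof. by have /asboolP[] := bop_funP T. Qed.

Lemma bop1_subproof : idfun \in @bop_pred R p X.
Proof. by apply/asboolP; split => //; exists 1 => f; rewrite mul1r. Qed.

Lemma bopM_subproof S T : S \o T \in @bop_pred R p X.
Proof.
apply/asboolP; split=> [c f g|]; first by rewrite /= !bop_linear.
have [M SM] := bop_bounded S; have [N TN] := bop_bounded T.
exists (`|M| * N) => f; apply: le_trans (SM _) _; rewrite -mulrA.
apply: le_trans (ler_wpM2l (normr_ge0 M) (TN f)).
by rewrite ler_wpM2r ?lpnorm_ge0 ?ler_norm.
Qed.

Definition bop1 : bop p X := Bop bop1_subproof.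
Definition bopM S T : bop p X := Bop (bopM_subproof S T).

Lemma bopDE S T f : (S + T) f = S f + T f. Proof. by []. Qed.
Lemma bopNE S f : (- S) f = - S f. Proof. by []. Qed.
Lemma bop0E f : (0 : bop p X) f = 0. Proof. by []. Qed.
Lemma bopZE c S f : (c *: S) f = c *: S f. Proof. by []. Qed.

HB.instance Definition _ T := GRing.isLinear.Build _ _ _ _ (bop_fun T) (bop_linear T).

Lemma bopMA : associative bopM.
Proof. by move=> S T U; exact: bop_ext. Qed.
Lemma bop1M : left_id bop1 bopM.
Proof. by move=> S; exact: bop_ext. Qed.
Lemma bopM1 : right_id bop1 bopM.
Proof. by move=> S; exact: bop_ext. Qed.
Lemma bopMDl : left_distributive bopM +%R.
Proof. by move=> S T U; exact: bop_ext. Qed.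
Lemma bopMDr : right_distributive bopM +%R.
Proof. by move=> S T U; apply: bop_ext => f; exact: (linearD S). Qed.

HB.instance Definition _ := GRing.Zmodule_isPzRing.Build (bop p X)
  bopMA bop1M bopM1 bopMDl bopMDr.

Lemma bopME S T f : (S * T) f = S (T f). Proof. by []. Qed.
Lemma bop1E f : (1 : bop p X) f = f. Proof. by []. Qed.

Definition opnorm T : R :=
  sup [set lpnorm (T f) | f in [set f | lpnorm f <= 1]].

Let opset_nonempty T : [set lpnorm (T f) | f in [set f | lpnorm f <= 1]] !=set0.
Proof. by exists (lpnorm (T 0)); exists 0 => //=; rewrite lpnorm0 ler01. Qed.

Let opset_ubound T : has_ubound [set lpnorm (T f) | f in [set f | lpnorm f <= 1]].
Proof.
have [M TM] := bop_bounded T; exists `|M| => _ [f /= f1 <-].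
apply: le_trans (TM f) _; apply: le_trans (ler_norm _) _.
by rewrite normrM [ `|lpnorm f|]ger0_norm ?lpnorm_ge0// ler_piMr.
Qed.

Lemma opnorm_ge0 T : 0 <= opnorm T.
Proof.
apply: le_trans (lpnorm_ge0 (T 0)) _; apply: ub_le_sup => //.
by exists 0 => //=; rewrite lpnorm0 ler01.
Qed.

Lemma lpnorm_opnorm T f : lpnorm (T f) <= opnorm T * lpnorm f.
Proof.
have [f0|f0] := eqVneq (lpnorm f) 0.
  by rewrite (lpnorm0_eq0 f0) linear0 lpnorm0 mulr0.
have {}f0 : 0 < lpnorm f by rewrite lt_def f0 lpnorm_ge0.
have nf : normc (lpnorm f)^-1%:C%C = (lpnorm f)^-1.
  by rewrite normcR// invr_ge0 lpnorm_ge0.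
rewrite -ler_pdivrMr//.
have <- : lpnorm (T ((lpnorm f)^-1%:C%C *: f)) = lpnorm (T f) / lpnorm f.
  by rewrite linearZ lpnormZ nf mulrC.
apply: ub_le_sup; first exact: opset_ubound.
exists ((lpnorm f)^-1%:C%C *: f) => //=.
by rewrite lpnormZ nf mulVf// gt_eqF.
Qed.

Lemma opnorm_le T M : (forall f, lpnorm (T f) <= M * lpnorm f) -> 0 <= M ->
  opnorm T <= M.
Proof.
move=> TM M0; apply: ge_sup => // _ [f /= f1 <-].
by apply: le_trans (TM f) _; rewrite ler_piMr.
Qed.

Lemma opnormD S T : opnorm (S + T) <= opnorm S + opnorm T.
Proof.
apply: opnorm_le; rewrite ?addr_ge0 ?opnorm_ge0// => f.
apply: le_trans (lpnormD _ _) _.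
by rewrite mulrDl lerD ?lpnorm_opnorm.
Qed.

Lemma opnormM S T : opnorm (S * T) <= opnorm S * opnorm T.
Proof.
apply: opnorm_le; rewrite ?mulr_ge0 ?opnorm_ge0// => f.
apply: le_trans (lpnorm_opnorm S (T f)) _.
rewrite -(mulrA (opnorm S)).
exact: (ler_wpM2l (opnorm_ge0 S) (lpnorm_opnorm T f)).
Qed.

Lemma opnormZ_le c T : opnorm (c *: T) <= normc c * opnorm T.
Proof.
apply: opnorm_le; rewrite ?mulr_ge0 ?normc_ge0 ?opnorm_ge0// => f.
by rewrite lpnormZ -mulrA ler_wpM2l ?normc_ge0 ?lpnorm_opnorm.
Qed.

Lemma opnorm0 : opnorm 0 = 0.
Proof.
apply/le_anti; rewrite opnorm_ge0 andbT; apply: opnorm_le => // f.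
by rewrite lpnorm0 mul0r.
Qed.

Lemma lp_delta_subproof (y : X) :
  (fun x => (x == y)%:R : R[i]) \in @lp_pred R p X.
Proof.
apply/asboolP; rewrite /lp_pow.
rewrite (_ : esum _ _ = 1%E) ?ltry// -[RHS](@esum_set1 R X y (fun=> 1%E))//.
rewrite [RHS]esum_mkcond; apply: eq_esum => x _.
have [->|xy] := eqVneq x y; first by rewrite normc1 powR1 mem_set.
by rewrite normc0 powR0 ?exponent_neq0// memNset//= => /eqP; rewrite (negbTE xy).
Qed.

Definition delta y : lp p X := Lp (lp_delta_subproof y).

Definition entry T x y : R[i] := T (delta y) x.
End BopRing.

Section Approx.
Context {R : realType} (p : exponent R) (X : choiceType).
Implicit Types (S T U : bop p X) (f g : lp p X).

Lemma lp_sumE (s : seq X) (F : X -> lp p X) x :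
  (\sum_(y <- s) F y) x = \sum_(y <- s) F y x.
Proof. by elim/big_ind2 : _ => // h1 c1 h2 c2 <- <-. Qed.

Lemma lp_approx f (e : R) : 0 < e ->
  exists2 s : seq X, uniq s & lpnorm (f - \sum_(y <- s) f y *: delta p y) < e.
Proof.
move=> e0; pose d := (e / 2) `^ p.
have d0 : 0 < d by rewrite powR_gt0// divr_gt0.
have : ((lpnorm f `^ p - d)%:E < lp_pow p f)%E.
  by rewrite lp_powE lte_fin ltrBlDr ltrDl.
case/ereal_sup_gt => _ [A [finA _] <-] Af.
pose s := finmap.enum_fset (fset_set A).
have us : uniq s by exact: finmap.fset_uniq.
exists s => //.
pose g := f - \sum_(y <- s) f y *: delta p y.
rewrite -/g.
have sA x : (x \in s) = (x \in A) by rewrite -in_fset_set.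
have gE x : g x = if x \in A then 0 else f x.
  have sE : (\sum_(y <- s) f y *: delta p y) x = \sum_(y <- s) f y * (x == y)%:R.
    by rewrite lp_sumE; apply: eq_bigr => y _; exact: lpZE.
  rewrite /g lpDE lpNE sE -sA; case: ifPn => xs.
    rewrite (bigD1_seq x)//= eqxx mulr1 big1 ?addr0 ?subrr//.
    by move=> y yx; rewrite eq_sym (negbTE yx) mulr0.
  rewrite big_seq big1 ?subr0// => y ys /=; case: eqVneq => [xy|]; last by rewrite mulr0.
  by rewrite xy ys in xs.
have fg : (lp_pow p f = \sum_(x \in A) (normc (f x) `^ p)%:E + lp_pow p g)%E.
  rewrite {1}/lp_pow (esumID A)//; last by move=> x _; rewrite lee_fin powR_ge0.
  congr (_ + _)%E.
    by rewrite setTI esum_fset// => *; rewrite lee_fin powR_ge0.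
  rewrite setTI esum_mkcond; apply: eq_esum => x _; rewrite gE in_setC.
  case: (x \in A) => //; transitivity ((normc (0 : R[i]) `^ p)%:E) => //.
  by rewrite normc0 powR0// exponent_neq0.
apply: (@le_lt_trans _ _ (e / 2)); last by rewrite ltr_pdivrMr// mulr2n mulrDr mulr1 ltrDl.
apply: lpnorm_le; first by rewrite divr_ge0// ltW.
move: Af fg; rewrite fsumEFin// !lp_powE -EFinD lte_fin => Af [fg].
have aux (a b c : R) : a - d < b -> a = b + c -> c <= d.
  by move=> h ac; move: h; rewrite {}ac ltrBlDr ltrD2l => /ltW.
rewrite lee_fin; exact: (aux _ _ _ Af fg).
Qed.

Lemma entry0 T f x : (forall y, f y != 0 -> entry T x y = 0) -> T f x = 0.
Proof.
move=> Tf; apply/eqP/negP => /negP Tfx.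
have c0 : 0 < normc (T f x).
  by rewrite lt_def normc_ge0 andbT; apply: contra Tfx => /eqP/eq0_normc/eqP.
have M0 : 0 < opnorm T + 1 by rewrite ltr_wpDl ?opnorm_ge0.
have [s us fs] := lp_approx f (divr_gt0 c0 M0).
have Tg : T (\sum_(y <- s) f y *: delta p y) x = 0.
  rewrite linear_sum lp_sumE big1// => y _; rewrite linearZ lpZE.
  have [->|fy] := eqVneq (f y) 0; first by rewrite mul0r.
  by rewrite [T _ x]Tf// mulr0.
move: fs Tg; set g := \sum_(y <- s) _ => fs Tg.
have : normc (T f x) <= lpnorm (T (f - g)).
  apply: le_trans (normc_le_lpnorm _ x).
  by rewrite linearB lpDE lpNE Tg subr0.
rewrite leNgt => /negP; apply; apply: le_lt_trans (lpnorm_opnorm _ _) _.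
apply: le_lt_trans (_ : (opnorm T + 1) * lpnorm (f - g) < _).
  by rewrite ler_wpM2r ?lpnorm_ge0// lerDl.
by rewrite mulrC -ltr_pdivlMr.
Qed.
End Approx.

Section Roe.
Context {R : realType} (p : exponent R) (X : metricType R).
Implicit Types S T : bop p X.

(* The point 0 is added so that the zero operator has propagation 0, not -oo. *)
Definition propagation T : \bar R :=
  ereal_sup (0%E |` [set (mdist xy.1 xy.2)%:E | xy in [set xy | entry T xy.1 xy.2 != 0]]).

Definition finite_propagation T := (propagation T < +oo)%E.

(* Operator norm closure of the finite propagation operators: membership in the
   l^p uniform Roe algebra B^p_u(X), whose elements form the type roe p X. *)
Definition roe_pred : {pred bop p X} := fun T =>
  `[< forall e : R, 0 < e -> exists2 S, finite_propagation S & opnorm (T - S) < e >].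

Lemma finite_propagationP T : finite_propagation T <->
  exists2 r, 0 <= r & forall x y, entry T x y != 0 -> mdist x y <= r.
Proof.
split=> [fT|[r r0 Tr]]; last first.
  apply: le_lt_trans (ltry r); apply: ge_ereal_sup => _ [->|[[x y] /= xy <-]].
    by rewrite lee_fin.
  by rewrite lee_fin Tr.
have p0 : (0 <= propagation T)%E by apply: ereal_sup_ubound; left.
have pf : propagation T \is a fin_num by rewrite ge0_fin_numE.
exists (fine (propagation T)); first exact: fine_ge0.
move=> x y xy; rewrite -lee_fin fineK//; apply: ereal_sup_ubound; right.
by exists (x, y).
Qed.

Lemma finite_propagation0 : finite_propagation 0.
Proof. by apply/finite_propagationP; exists 0 => // x y; rewrite /entry bop0E lp0E eqxx. Qed.

Lemma finite_propagation1 : finite_propagation 1.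
Proof.
apply/finite_propagationP; exists 0 => // x y; rewrite /entry bop1E /=.
by have [->|] := eqVneq x y; rewrite ?mdistxx// eqxx.
Qed.

Lemma finite_propagationD S T :
  finite_propagation S -> finite_propagation T -> finite_propagation (S + T).
Proof.
move=> /finite_propagationP[r r0 Sr] /finite_propagationP[s s0 Ts].
apply/finite_propagationP; exists (r + s); first exact: addr_ge0.
move=> x y; rewrite /entry bopDE lpDE => xy.
have [S0|/Sr] := eqVneq (entry S x y) 0; last by move/le_trans; apply; rewrite lerDl.
move: xy; rewrite [S _ x]S0 add0r => /Ts /le_trans; apply; rewrite lerDr//.
Qed.

Lemma finite_propagationZ c T : finite_propagation T -> finite_propagation (c *: T).
Proof.
move=> /finite_propagationP[r r0 Tr].
apply/finite_propagationP; exists r => // x y; rewrite /entry bopZE lpZE.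
by rewrite mulf_eq0 negb_or => /andP[_ /Tr].
Qed.

Lemma finite_propagationM S T :
  finite_propagation S -> finite_propagation T -> finite_propagation (S * T).
Proof.
move=> /finite_propagationP[r r0 Sr] /finite_propagationP[s s0 Ts].
apply/finite_propagationP; exists (r + s); first exact: addr_ge0.
move=> x y; rewrite /entry bopME => xy.
suff [z Sz Tz] : exists2 z, entry S x z != 0 & entry T z y != 0.
  by apply: le_trans (metric_triangle _ z _) _; rewrite lerD ?Sr ?Ts.
apply: contrapT => h; move/eqP: xy; apply; apply: entry0 => z Tz.
by apply: contrapT => /eqP Sz; apply: h; exists z.
Qed.

Lemma roe_pred_subsemimod : GRing.subsemimod_closed roe_pred.
Proof.
split; [split|].
- apply/asboolP => e e0; exists 0; first exact: finite_propagation0.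
  by rewrite subr0 opnorm0.
- move=> S T /asboolP Sa /asboolP Ta; apply/asboolP => e e0.
  have [S' S'f SS'] := Sa _ (divr_gt0 e0 (ltr0n R 2)).
  have [T' T'f TT'] := Ta _ (divr_gt0 e0 (ltr0n R 2)).
  exists (S' + T'); first exact: finite_propagationD.
  rewrite opprD addrACA (splitr e).
  exact: (le_lt_trans (opnormD _ _) (ltrD SS' TT')).
- move=> c T /asboolP Ta; apply/asboolP => e e0.
  have c0 : 0 < normc c + 1 by rewrite ltr_wpDl ?normc_ge0.
  have [T' T'f TT'] := Ta _ (divr_gt0 e0 c0).
  exists (c *: T'); first exact: finite_propagationZ.
  rewrite -scalerBr; apply: le_lt_trans (opnormZ_le _ _) _.
  rewrite ltr_pdivlMr// mulrC in TT'; apply: le_lt_trans TT'.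
  by rewrite ler_wpM2r ?opnorm_ge0// lerDl.
Qed.

Lemma roe_pred_subring : GRing.subring_closed roe_pred.
Proof.
have [[_ roeD] roeZ] := roe_pred_subsemimod.
split.
- apply/asboolP => e e0; exists 1; first exact: finite_propagation1.
  by rewrite subrr opnorm0.
- move=> S T Sr Tr; have := roeD _ _ Sr (roeZ (-1) _ Tr).
  by rewrite scaleN1r.
- move=> S T /asboolP Sa /asboolP Ta; apply/asboolP => e e0.
  have e20 : 0 < e / 2 by rewrite divr_gt0.
  have S0 : 0 < opnorm S + 1 by rewrite ltr_wpDl ?opnorm_ge0.
  have [T' T'f TT'] := Ta _ (divr_gt0 e20 S0).
  have T0 : 0 < opnorm T' + 1 by rewrite ltr_wpDl ?opnorm_ge0.
  have [S' S'f SS'] := Sa _ (divr_gt0 e20 T0).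
  exists (S' * T'); first exact: finite_propagationM.
  have -> : S * T - S' * T' = S * (T - T') + (S - S') * T'.
    by rewrite mulrBr mulrBl addrA subrK.
  have aux (a b c : R) : 0 <= a -> 0 <= b -> b < c / (a + 1) -> a * b < c.
    move=> a0 b0; rewrite ltr_pdivlMr ?ltr_wpDl//; apply: le_lt_trans.
    by rewrite mulrC ler_wpM2l// lerDl.
  rewrite (splitr e); apply: le_lt_trans (opnormD _ _) _; apply: ltrD.
    exact: (le_lt_trans (opnormM _ _) (aux _ _ _ (opnorm_ge0 _) (opnorm_ge0 _) TT')).
  apply: (le_lt_trans (opnormM _ _)); rewrite mulrC.
  exact: (aux _ _ _ (opnorm_ge0 _) (opnorm_ge0 _) SS').
Qed.
End Roe.

Record roe (R : realType) (p : exponent R) (X : metricType R) := RoeOp {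
  roe_val :> bop p X;
  roe_valP : roe_val \in @roe_pred R p X }.

Section RoeRing.
Context {R : realType} (p : exponent R) (X : metricType R).

HB.instance Definition _ := [isSub for @roe_val R p X].
HB.instance Definition _ := [Choice of roe p X by <:].
HB.instance Definition _ := GRing.SubChoice_isSubPzRing.Build _ _ (roe p X)
  (@roe_pred_subring R p X).
HB.instance Definition _ := GRing.SubZmodule_isSubLmodule.Build _ _ _ (roe p X)
  (@roe_pred_subsemimod R p X).

(* Multiplication by a bounded function g: such operators have propagation 0,
   so all of them belong to the algebra. *)
Definition ell_infty : set (roe p X) :=
  [set T | exists2 g : X -> R[i], (exists M, forall x, normc (g x) <= M) &
     forall (f : lp p X) x, (T : bop p X) f x = g x * f x].
End RoeRing.
Arguments ell_infty {R} p X.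

(* Preservation of the unit follows from bijectivity and multiplicativity. *)
Definition isometric_isomorphism (R : realType) (p : exponent R) (X Y : metricType R)
  (phi : roe p X -> roe p Y) : Prop :=
  [/\ bijective phi, linear phi, {morph phi : S T / S * T} &
     forall T, opnorm (phi T) = opnorm T].

Section Grothendieck.
Variable M : nmodType.
Implicit Types u v w : M * M.
Local Open Scope quotient_scope.

(* u and v stand for the formal differences u.1 - u.2 and v.1 - v.2. *)
Definition groth_rel : rel (M * M) := fun u v =>
  `[< exists k, u.1 + v.2 + k = v.1 + u.2 + k >].

Lemma groth_rel_refl : reflexive groth_rel.
Proof. by move=> u; apply/asboolP; exists 0. Qed.

Lemma groth_rel_sym : symmetric groth_rel.
Proof. by move=> u v; apply/asboolP/asboolP => -[k h]; exists k. Qed.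

Lemma groth_rel_trans : transitive groth_rel.
Proof.
move=> v u w /asboolP[k h] /asboolP[l h']; apply/asboolP.
exists (v.2 + v.1 + k + l).
transitivity ((u.1 + v.2 + k) + (v.1 + w.2 + l)).
  by rewrite [LHS](AC (2*4) ((1*3*5)*(4*2*6))).
rewrite h h' [LHS](AC (3*3) ((4*2)*(5*1*3*6))).
by [].
Qed.

Canonical groth_equiv := EquivRel groth_rel groth_rel_refl groth_rel_sym groth_rel_trans.

Definition groth := {eq_quot groth_equiv}.
HB.instance Definition _ := Choice.on groth.
HB.instance Definition _ := EqQuotient.on groth.

Definition groth_class u : groth := \pi_groth u.

Lemma groth_classP u v : reflect (exists k, u.1 + v.2 + k = v.1 + u.2 + k)
  (groth_class u == groth_class v).
Proof. by apply: (iffP eqP) => [/eqmodP/asboolP|h]//; apply/eqmodP/asboolP. Qed.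

Lemma groth_classW (P : groth -> Prop) : (forall u, P (groth_class u)) -> forall x, P x.
Proof. by move=> h x; rewrite -[x]reprK; exact: h. Qed.

Lemma groth_class_repr u : groth_rel (repr (groth_class u)) u.
Proof. by apply/(@eqmodP _ groth_equiv); rewrite reprK. Qed.

Definition groth_zero := groth_class 0.
Definition groth_add (x y : groth) := groth_class (repr x + repr y).
Definition groth_opp (x : groth) := groth_class ((repr x).2, (repr x).1).

Lemma groth_addE u v : groth_add (groth_class u) (groth_class v) = groth_class (u + v).
Proof.
apply/eqP/groth_classP => /=.
have /asboolP[k hk] := groth_class_repr u; have /asboolP[l hl] := groth_class_repr v.
move: hk hl; set a := repr _; set b := repr _ => hk hl; exists (k + l).
transitivity ((a.1 + u.2 + k) + (b.1 + v.2 + l)).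
  by rewrite [LHS](AC (2*2*2) ((1*3*5)*(2*4*6))).
by rewrite hk hl [LHS](AC (3*3) ((1*4)*(2*5)*(3*6))).
Qed.

Lemma groth_oppE u : groth_opp (groth_class u) = groth_class (u.2, u.1).
Proof.
apply/eqP/groth_classP => /=.
have /asboolP[k] := groth_class_repr u; set a := repr _ => hk; exists k.
by rewrite (addrC a.2) -hk (addrC u.2).
Qed.

Lemma groth_addA : associative groth_add.
Proof.
elim/groth_classW=> u; elim/groth_classW=> v; elim/groth_classW=> w.
by rewrite !groth_addE addrA.
Qed.

Lemma groth_addC : commutative groth_add.
Proof.
by elim/groth_classW=> u; elim/groth_classW=> v; rewrite !groth_addE addrC.
Qed.

Lemma groth_add0 : left_id groth_zero groth_add.
Proof. by elim/groth_classW=> u; rewrite groth_addE add0r. Qed.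

Lemma groth_addN : left_inverse groth_zero groth_opp groth_add.
Proof.
elim/groth_classW=> u; rewrite groth_oppE groth_addE.
by apply/eqP/groth_classP; exists 0; rewrite /= !addr0 add0r addrC.
Qed.

HB.instance Definition _ := GRing.isZmodule.Build groth
  groth_addA groth_addC groth_add0 groth_addN.
End Grothendieck.

Section Idempotents.
Variable A : pzRingType.

Record idempotent := Idempotent {
  idem_dim : nat;
  idem_mx :> 'M[A]_(idem_dim, idem_dim);
  idem_mxP : idem_mx *m idem_mx = idem_mx }.

HB.instance Definition _ := gen_eqMixin idempotent.
HB.instance Definition _ := gen_choiceMixin idempotent.

Implicit Types e f g : idempotent.
Local Open Scope quotient_scope.

(* Algebraic (Murray-von Neumann) equivalence of idempotents in matrix algebras
   of possibly different sizes; rectangular x and y make it insensitive to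
   padding by zeros, so this is equivalence of idempotents in M_oo(A).  For a
   Banach algebra it yields the same K_0 as similarity or homotopy in M_oo(A). *)
Definition idem_rel : rel idempotent := fun e f =>
  `[< exists x : 'M[A]_(idem_dim e, idem_dim f), exists y : 'M[A]_(idem_dim f, idem_dim e),
        x *m y = idem_mx e /\ y *m x = idem_mx f >].

Lemma idem_rel_refl : reflexive idem_rel.
Proof. by move=> e; apply/asboolP; exists e, e; rewrite idem_mxP. Qed.

Lemma idem_rel_sym : symmetric idem_rel.
Proof. by move=> e f; apply/asboolP/asboolP => -[x [y [? ?]]]; exists y, x. Qed.

Lemma idem_rel_trans : transitive idem_rel.
Proof.
move=> f e g /asboolP[x [y [xy yx]]] /asboolP[z [w [zw wz]]].
apply/asboolP; exists (x *m z), (w *m y); split.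
  by rewrite mulmxA -(mulmxA x) zw -yx mulmxA xy -mulmxA xy idem_mxP.
by rewrite mulmxA -(mulmxA w) yx -zw mulmxA wz -mulmxA wz idem_mxP.
Qed.

Canonical idem_equiv := EquivRel idem_rel idem_rel_refl idem_rel_sym idem_rel_trans.

Definition idemV := {eq_quot idem_equiv}.
HB.instance Definition _ := Choice.on idemV.
HB.instance Definition _ := EqQuotient.on idemV.

Definition idem_class e : idemV := \pi_idemV e.

Lemma idem_classP e f : reflect
  (exists x : 'M[A]_(idem_dim e, idem_dim f), exists y : 'M[A]_(idem_dim f, idem_dim e),
     x *m y = idem_mx e /\ y *m x = idem_mx f)
  (idem_class e == idem_class f).
Proof. by apply: (iffP eqP) => [/eqmodP/asboolP|h]//; apply/eqmodP/asboolP. Qed.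

Lemma idem_classW (P : idemV -> Prop) : (forall e, P (idem_class e)) -> forall x, P x.
Proof. by move=> h x; rewrite -[x]reprK; exact: h. Qed.

Lemma idem_class_repr e : idem_rel (repr (idem_class e)) e.
Proof. by apply/(@eqmodP _ idem_equiv); rewrite reprK. Qed.

Lemma idem_sum_subproof e f :
  let s := block_mx (idem_mx e) 0 0 (idem_mx f) in s *m s = s.
Proof. by rewrite /= mulmx_block !mul0mx !mulmx0 !idem_mxP !addr0 !add0r. Qed.

Definition idem_sum e f := Idempotent (idem_sum_subproof e f).

Lemma idem0_subproof : (0 : 'M[A]_(0, 0)) *m (0 : 'M[A]_(0, 0)) = 0.
Proof. exact: mul0mx. Qed.

Definition idem0 := Idempotent idem0_subproof.

Definition idemV_zero := idem_class idem0.
Definition idemV_add (x y : idemV) := idem_class (idem_sum (repr x) (repr y)).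

Lemma idemV_addE e f : idemV_add (idem_class e) (idem_class f) = idem_class (idem_sum e f).
Proof.
apply/eqP/idem_classP.
have /asboolP[x [y [xy yx]]] := idem_class_repr e.
have /asboolP[z [w [zw wz]]] := idem_class_repr f.
exists (block_mx x 0 0 z), (block_mx y 0 0 w).
by rewrite !mulmx_block !mul0mx !mulmx0 !addr0 !add0r xy yx zw wz.
Qed.

Lemma idempotent_ext e f (E : idem_dim e = idem_dim f) :
  castmx (E, E) (idem_mx e) = idem_mx f -> e = f.
Proof.
case: e f E => n e he [m f hf] /= E; case: m / E f hf => f hf.
rewrite castmx_id => ef; case: f / ef hf => hf.
by congr Idempotent; exact: Prop_irrelevance.
Qed.

Lemma idemV_addA : associative idemV_add.
Proof.
elim/idem_classW=> e; elim/idem_classW=> f; elim/idem_classW=> g.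
rewrite !idemV_addE; congr idem_class; apply/esym.
pose E := esym (addnA (idem_dim e) (idem_dim f) (idem_dim g)).
apply: (@idempotent_ext (idem_sum (idem_sum e f) g) (idem_sum e (idem_sum f g)) E).
have := @block_mxA A _ _ _ _ _ _ (idem_mx e) 0 0 0 (idem_mx f) 0 0 0 (idem_mx g).
by rewrite /= !row_mx0 !col_mx0 => ->.
Qed.

Lemma idemV_addC : commutative idemV_add.
Proof.
elim/idem_classW=> e; elim/idem_classW=> f; rewrite !idemV_addE.
apply/eqP/idem_classP.
exists (block_mx 0 (idem_mx e) (idem_mx f) 0), (block_mx 0 (idem_mx f) (idem_mx e) 0).
by rewrite !mulmx_block !mul0mx !mulmx0 !addr0 !add0r !idem_mxP.
Qed.

Lemma idemV_add0 : left_id idemV_zero idemV_add.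
Proof.
elim/idem_classW=> e; rewrite !idemV_addE; apply/eqP/idem_classP.
exists (col_mx 0 (idem_mx e)), (row_mx 0 (idem_mx e)).
by rewrite mul_col_row mul_row_col !mul0mx !mulmx0 add0r idem_mxP; split=> //.
Qed.

HB.instance Definition _ := GRing.isNmodule.Build idemV
  idemV_addA idemV_addC idemV_add0.

Definition K0 := groth idemV.
HB.instance Definition _ := GRing.Zmodule.on K0.

Definition K0_class e : K0 := groth_class (idem_class e, 0).

Definition K0_pos : set K0 := range K0_class.

Lemma idem1_subproof : (1%:M : 'M[A]_(1, 1)) *m (1%:M : 'M[A]_(1, 1)) = 1%:M.
Proof. exact: mul1mx. Qed.

Definition K0_unit : K0 := K0_class (Idempotent idem1_subproof).
End Idempotents.

Arguments K0_pos A : clear implicits.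
Arguments K0_unit A : clear implicits.

Definition K0_pair_iso (A B : pzRingType) : Prop :=
  exists h : {additive K0 A -> K0 B},
    bijective h /\ h (K0_unit A) = K0_unit B.

Definition K0_triple_iso (A B : pzRingType) : Prop :=
  exists h : {additive K0 A -> K0 B},
    [/\ bijective h, h @` K0_pos A = K0_pos B & h (K0_unit A) = K0_unit B].

Section Coarse.
Context {R : realType}.
Implicit Types X Y : metricType R.

Definition uniformly_expansive X Y (f : X -> Y) : Prop :=
  forall r : R, 0 < r -> exists2 s : R, 0 < s &
    forall x1 x2, mdist x1 x2 <= r -> mdist (f x1) (f x2) <= s.

Definition close_maps X Y (f g : X -> Y) : Prop :=
  exists c : R, forall x, mdist (f x) (g x) <= c.

Definition coarse_equivalence X Y (f : X -> Y) : Prop :=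
  uniformly_expansive f /\
  exists g : Y -> X, [/\ uniformly_expansive g,
    close_maps (f \o g) idfun & close_maps (g \o f) idfun].

Definition bijectively_coarsely_equivalent X Y : Prop :=
  exists2 f : X -> Y, coarse_equivalence f & bijective f.
End Coarse.

(* A group with a metric on its carrier.  No compatibility between the two is
   built in: see left_invariant below.  The topology carried by a metricType is
   determined by its distance. *)
#[short(type="metricGroupType")]
HB.structure Definition MetricGroup (R : numDomainType) :=
  {G of Metric R G & Group G}.

Definition generated_subgroup (G : groupType) (s : seq G) : set G :=
  smallest (fun H : set G => group_closed (mem H)) [set` s].

Definition locally_finite (G : groupType) : Prop :=
  forall s : seq G, finite_set (generated_subgroup s).

Definition proper_metric (R : realType) (X : metricType R) : Prop :=
  forall (x : X) (r : R), finite_set [set y | mdist x y <= r].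

Definition left_invariant (R : realType) (G : metricGroupType R) : Prop :=
  forall g x y : G, mdist (g * x)%g (g * y)%g = mdist x y.

(* Main.v *)
Require Import Defs.
From HB Require Import structures.
From mathcomp Require Import all_boot all_order all_algebra.
From mathcomp Require Import complex ring lra.
From mathcomp Require Import all_classical all_reals all_analysis.
Set Implicit Arguments.
Unset Strict Implicit.
Unset Printing Implicit Defensive.
Import Order.TTheory GRing.Theory Num.Theory Normc.
Import numFieldNormedType.Exports.
Local Open Scope classical_set_scope.
Local Open Scope ring_scope.

(** A locally finite group with a proper left-invariant metric is the union of
    the finite subgroups F_k generated by its balls about 1, and the partition
    into left cosets of F_k is bounded while every pair of points at distance at
    most r lies in a common coset as soon as F_k contains the ball of radius r.
    Listing each F_(k+1) coset by coset, starting with F_k, ranks the elements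
    of the group by natural numbers in such a way that the cosets of F_k become
    the blocks of |F_k| consecutive integers ([group_tower]).  The chain of
    numbers |F_0|, |F_1|, ..., each dividing the next, thus determines the group
    up to bijective coarse equivalence, and so does the set of all divisors of
    its terms: if each |F_k| divides some |E_l| and conversely, matching
    equal ranks is a bijective coarse equivalence between the two groups
    ([tower_coarse_equivalent]).

    The divisors are recovered from the unit class: d divides [1] in K_0 if and
    only if d divides some |F_k|.  If d divides |F_k|, every block splits into d
    colours of equal size; the diagonal projections on the colours sum to 1 and
    are equivalent through operators that permute the points inside blocks
    ([tower_divides]).

    Conversely ([tower_divisor]), let phi_m be the compression of an operator to
    F_m, with values in the operators on a finite l^p space.  These maps are
    contractive, and multiplicative up to an error that tends to 0, because an
    operator of finite propagation preserves l^p(F_m) for large m.  An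
    idempotent e over the Roe algebra is mapped to an almost idempotent matrix,
    which Newton iteration corrects to an idempotent close to it
    ([near_idempotent]), and two idempotents that are equivalent over the
    algebra yield corrections that are equivalent for large m
    ([near_equivalence]).  The traces of the corrections are natural numbers,
    additive in e, and the unit has trace |F_m|; so [1] = d x forces d to divide
    |F_m| for all large m ([K0_unit_divisor]).

    Hence an isomorphism of the pairs (K_0, [1]) for one exponent yields a
    bijective coarse equivalence.  Such a map conjugates the Roe algebras
    isometrically for every exponent, preserving the diagonal
    ([coarse_bijection_isometric_isomorphism]), and isomorphic rings have
    isomorphic ordered K_0 groups ([ring_isomorphism_K0_triple_iso]).  To pass
    from an isomorphism of algebras at one exponent to K_0 at all exponents, the
    proof goes around this cycle through the coarse equivalence. *)

(** * Operators induced by partial injections *)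

(** Composition with a partial injection is a contraction between l^p spaces of
    different sets.  This one construction gives the conjugation by a bijection,
    the inclusion and projection of a finite block, the diagonal projections,
    and the operators that move one colour class onto another. *)
Record partial_inj (X Y : Type) := PartialInj {
  partial_inj_fun :> X -> option Y;
  partial_injP : forall x x' y, partial_inj_fun x = Some y -> partial_inj_fun x' = Some y -> x = x' }.

Lemma total_partial_inj_subproof (X Y : Type) (f : X -> Y) : injective f ->
  forall x x' y, Some (f x) = Some y -> Some (f x') = Some y -> x = x'.
Proof. by move=> fI x x' y [<-] [/esym/fI]. Qed.

Definition total_inj (X Y : Type) (f : X -> Y) (fI : injective f) : partial_inj X Y :=
  PartialInj (total_partial_inj_subproof fI).

Section Pullback.
Context {R : realType} (p : exponent R).
Implicit Types X Y Z : choiceType.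

(** The sum over the domain of s reindexes injectively to part of the sum over Y. *)
Lemma lp_pow_pull X Y (s : partial_inj X Y) (f : Y -> R[i]) :
  (lp_pow p (fun x => oapp f 0%R (s x)) <= lp_pow p f)%E.
Proof.
pose D := [set x | isSome (s x)].
have [/eqP D0|/set0P[x0]] := boolP (D == set0).
  rewrite {1}/lp_pow esum1 ?lp_pow_ge0// => x _.
  case E : (s x) => [y|]; last by rewrite /= expr0n/= addr0 sqrtr0 powR0 ?exponent_neq0.
  by have : D x; [rewrite /D /= E | rewrite D0].
rewrite /D /=; case E0 : (s x0) => [y0|]// _.
pose e x := odflt y0 (s x).
have eI : {in D &, injective e}.
  move=> x x'; rewrite !inE /D /e /=; case E : (s x) => [y|]// _.
  by case E' : (s x') => [y'|]//= _ yy'; apply: (partial_injP E); rewrite yy'.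
rewrite /lp_pow.
have -> : \esum_(x in [set: X]) (normc (oapp f 0%R (s x)) `^ p)%:E =
    \esum_(x in D) (normc (f (e x)) `^ p)%:E.
  rewrite [RHS]esum_mkcond; apply: eq_esum => x _; rewrite /e; case: ifPn.
    by rewrite inE /D /=; case: (s x).
  rewrite notin_setE /D /=; case: (s x) => //= _.
  by rewrite expr0n/= addr0 sqrtr0 powR0 ?exponent_neq0.
rewrite -(esum_image D e (fun y => (normc (f y) `^ p)%:E) eI) esum_mkcond.
by apply: le_esum => y _; case: ifP => _ //; rewrite lee_fin powR_ge0.
Qed.

Lemma lpull_subproof X Y (s : partial_inj X Y) (f : lp p Y) :
  (fun x => oapp f 0 (s x)) \in @lp_pred R p X.
Proof.
apply/asboolP; apply: le_lt_trans (lp_pow_pull s f) _.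
by have /asboolP := lp_valP f.
Qed.

Definition lpull X Y (s : partial_inj X Y) (f : lp p Y) : lp p X :=
  Lp (lpull_subproof s f).

Lemma lpullE X Y (s : partial_inj X Y) f x : lpull s f x = oapp f 0 (s x).
Proof. by []. Qed.

Lemma lpull_linear X Y (s : partial_inj X Y) : linear (lpull s).
Proof.
move=> c f g; apply: lp_ext => x.
rewrite lpDE lpZE !lpullE; case: (s x) => [y|]; first by [].
by rewrite /= mulr0 addr0.
Qed.

HB.instance Definition _ X Y (s : partial_inj X Y) :=
  GRing.isLinear.Build _ _ _ _ (lpull s) (lpull_linear s).

Lemma lpnorm_pull X Y (s : partial_inj X Y) f : lpnorm (lpull s f) <= lpnorm f.
Proof. by apply: lpnorm_le; rewrite ?lpnorm_ge0// -lp_powE lp_pow_pull. Qed.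

Lemma lpull_delta X Y (s : partial_inj X Y) x y :
  s x = Some y -> lpull s (delta p y) = delta p x.
Proof.
move=> sx; apply: lp_ext => z; rewrite lpullE /=.
have [->|zx] := eqVneq z x; first by rewrite sx /= eqxx.
case E : (s z) => [y'|]//=.
by case: eqP => // y'y; rewrite y'y in E; rewrite (partial_injP E sx) eqxx in zx.
Qed.

Lemma sandwich_subproof X Y (s : partial_inj Y X) (t : partial_inj X Y) (T : bop p X) :
  (fun f => lpull s (T (lpull t f))) \in @bop_pred R p Y.
Proof.
apply/asboolP; split=> [c f g|]; first by rewrite !linearP.
exists (opnorm T) => f; apply: le_trans (lpnorm_pull _ _) _.
apply: le_trans (lpnorm_opnorm _ _) _.
by rewrite ler_wpM2l ?opnorm_ge0 ?lpnorm_pull.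
Qed.

(** For inverse bijections s and t this is conjugation; for the inclusion and
    projection of a subset it is compression to that subset. *)
Definition sandwich X Y (s : partial_inj Y X) (t : partial_inj X Y) (T : bop p X) : bop p Y :=
  Bop (sandwich_subproof s t T).

Lemma sandwichE X Y (s : partial_inj Y X) (t : partial_inj X Y) T f :
  sandwich s t T f = lpull s (T (lpull t f)).
Proof. by []. Qed.

Lemma sandwich_linear X Y (s : partial_inj Y X) (t : partial_inj X Y) : linear (sandwich s t).
Proof.
by move=> c S T; apply: bop_ext => f; rewrite !(bopDE, bopZE, sandwichE) linearP.
Qed.

HB.instance Definition _ X Y (s : partial_inj Y X) (t : partial_inj X Y) :=
  GRing.isLinear.Build _ _ _ _ (sandwich s t) (sandwich_linear s t).

Lemma opnorm_sandwich X Y (s : partial_inj Y X) (t : partial_inj X Y) T :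
  opnorm (sandwich s t T) <= opnorm T.
Proof.
apply: opnorm_le; rewrite ?opnorm_ge0// => f; rewrite sandwichE.
apply: le_trans (lpnorm_pull _ _) _; apply: le_trans (lpnorm_opnorm _ _) _.
by rewrite ler_wpM2l ?opnorm_ge0 ?lpnorm_pull.
Qed.

End Pullback.

(** * Coarse bijections induce isometric isomorphisms *)

Section Conjugation.
Context {R : realType} (p : exponent R).

(** The set-theoretic inverse of a bijective coarse equivalence is close to any
    coarse inverse, so it is uniformly expansive as well. *)
Lemma coarse_bijection_inverse (X Y : metricType R) :
  bijectively_coarsely_equivalent X Y ->
  exists f : X -> Y, exists g : Y -> X,
    [/\ cancel f g, cancel g f, uniformly_expansive f & uniformly_expansive g].
Proof.
case=> f [fe [h [he _ [c hc]]]] [g fK gK]; exists f, g; split=> // r r0.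
have [s s0 hs] := he r r0; exists (`|c| + s + `|c|); first by rewrite ltr_wpDr// ltr_wpDl.
move=> y1 y2 y12.
have gh y : mdist (g y) (h y) <= `|c|.
  rewrite metric_sym; apply: le_trans (ler_norm _).
  by have := hc (g y); rewrite /= gK.
apply: le_trans (metric_triangle _ (h y1) _) _.
rewrite -addrA lerD//; apply: le_trans (metric_triangle _ (h y2) _) _.
by rewrite lerD ?hs// metric_sym.
Qed.

Lemma sandwichK (X Y : choiceType) (f : X -> Y) (g : Y -> X)
    (fI : injective f) (gI : injective g) : cancel f g -> cancel g f ->
  cancel (sandwich (p := p) (total_inj gI) (total_inj fI))
         (sandwich (total_inj fI) (total_inj gI)).
Proof.
move=> fK gK T; apply: bop_ext => h; rewrite !sandwichE.
apply: lp_ext => x; rewrite !lpullE /= fK; congr (bop_fun T _ _).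
by apply: lp_ext => z; rewrite !lpullE /= fK.
Qed.

Lemma sandwichM (X Y : choiceType) (f : X -> Y) (g : Y -> X)
    (fI : injective f) (gI : injective g) : cancel f g -> cancel g f ->
  {morph sandwich (p := p) (total_inj gI) (total_inj fI) : S T / S * T}.
Proof.
move=> fK gK S T; apply: bop_ext => h; rewrite !(sandwichE, bopME).
congr (lpull _ (bop_fun S _)).
by apply: lp_ext => z; rewrite !lpullE /= fK.
Qed.

Lemma finite_propagation_sandwich (X Y : metricType R) (f : X -> Y) (g : Y -> X)
    (fI : injective f) (gI : injective g) : cancel f g -> cancel g f ->
  uniformly_expansive f -> forall T : bop p X, finite_propagation T ->
  finite_propagation (sandwich (total_inj gI) (total_inj fI) T).
Proof.
move=> fK gK fe T /finite_propagationP[r r0 Tr]; apply/finite_propagationP.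
have [s s0 fs] := fe (r + 1) (ltr_wpDl r0 ltr01).
exists s; first exact: ltW.
move=> x y; rewrite /entry sandwichE (@lpull_delta _ _ _ _ _ (g y)); last first.
  by rewrite /= gK.
rewrite lpullE /= => /Tr xy; rewrite -[x]gK -[y]gK; apply: fs.
by apply: le_trans xy _; rewrite lerDl.
Qed.

Lemma sandwich_roe (X Y : metricType R) (f : X -> Y) (g : Y -> X)
    (fI : injective f) (gI : injective g) : cancel f g -> cancel g f ->
  uniformly_expansive f -> forall T : roe p X,
  sandwich (total_inj gI) (total_inj fI) T \in @roe_pred R p Y.
Proof.
move=> fK gK fe T; apply/asboolP => e e0.
have /asboolP/(_ e e0)[S Sf ST] := roe_valP T.
exists (sandwich (total_inj gI) (total_inj fI) S).
  exact: finite_propagation_sandwich.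
by rewrite -linearB; apply: le_lt_trans (opnorm_sandwich _ _ _) _.
Qed.

(** Conjugation by a bijection is isometric for every exponent; uniform
    expansiveness in both directions makes it preserve finite propagation. *)
Lemma coarse_bijection_isometric_isomorphism (X Y : metricType R) :
  bijectively_coarsely_equivalent X Y ->
  exists2 phi : roe p X -> roe p Y,
    isometric_isomorphism phi & phi @` ell_infty p X = ell_infty p Y.
Proof.
move=> /coarse_bijection_inverse[f [g [fK gK fe ge]]].
have fI := can_inj fK; have gI := can_inj gK.
pose phi (T : roe p X) : roe p Y := RoeOp (sandwich_roe fI gI fK gK fe T).
pose psi (T : roe p Y) : roe p X := RoeOp (sandwich_roe gI fI gK fK ge T).
have phiK : cancel phi psi by move=> T; apply: val_inj; exact: sandwichK.
have psiK : cancel psi phi by move=> T; apply: val_inj; exact: sandwichK.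
exists phi.
  split; first by exists psi.
  - move=> c S T; apply: val_inj; exact: sandwich_linear.
  - move=> S T; apply: val_inj; exact: sandwichM.
  - move=> T; apply/le_anti; rewrite opnorm_sandwich /=.
    by rewrite -{1}[T]phiK opnorm_sandwich.
apply/seteqP; split=> [_ [T [h [M hM] Th] <-]|T [h [M hM] Th]].
  exists (h \o g); first by exists M => x; exact: hM.
  move=> u y; rewrite sandwichE lpullE /=.
  by rewrite Th lpullE /= gK.
exists (psi T); last exact: psiK.
exists (h \o f); first by exists M => x; exact: hM.
by move=> u x; rewrite sandwichE lpullE /= Th lpullE /= fK.
Qed.

End Conjugation.

(** * Functoriality of K_0 *)

Lemma idem_class_sum (A : pzRingType) (e f : Defs.idempotent A) :
  idem_class e + idem_class f = idem_class (idem_sum e f).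
Proof. exact: idemV_addE. Qed.

Section K0Functoriality.
Context {A B : pzRingType}.
Implicit Types phi : {rmorphism A -> B}.

Lemma idem_map_subproof phi (e : Defs.idempotent A) :
  map_mx phi e *m map_mx phi e = map_mx phi e.
Proof. by rewrite -map_mxM idem_mxP. Qed.

Definition idem_map phi e : Defs.idempotent B := Idempotent (idem_map_subproof phi e).

Definition idemV_map phi (x : idemV A) : idemV B := idem_class (idem_map phi (repr x)).

Lemma idemV_mapE phi e : idemV_map phi (idem_class e) = idem_class (idem_map phi e).
Proof.
apply/eqP/idem_classP; have /asboolP[x [y [xy yx]]] := idem_class_repr e.
by exists (map_mx phi x), (map_mx phi y); rewrite -!map_mxM xy yx.
Qed.

Lemma idemV_mapD phi : {morph idemV_map phi : x y / x + y}.
Proof.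
elim/idem_classW=> e; elim/idem_classW=> f.
rewrite idem_class_sum !idemV_mapE idem_class_sum; congr idem_class.
apply: (@idempotent_ext _ (idem_map phi (idem_sum e f))
          (idem_sum (idem_map phi e) (idem_map phi f)) erefl).
by rewrite castmx_id /= map_block_mx !raddf0.
Qed.

Lemma idemV_map0 phi : idemV_map phi 0 = 0.
Proof.
rewrite [LHS]idemV_mapE; congr idem_class.
apply: (@idempotent_ext _ (idem_map phi (idem0 A)) (idem0 B) erefl).
by rewrite castmx_id /= raddf0.
Qed.

Definition K0_map phi (x : K0 A) : K0 B :=
  groth_class (idemV_map phi (repr x).1, idemV_map phi (repr x).2).

Lemma K0_mapE phi u :
  K0_map phi (groth_class u) = groth_class (idemV_map phi u.1, idemV_map phi u.2).
Proof.
apply/eqP/groth_classP => /=; have /asboolP[k hk] := groth_class_repr u.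
by exists (idemV_map phi k); rewrite -!idemV_mapD hk.
Qed.

Lemma K0_map_is_additive phi : {morph K0_map phi : x y / x - y}.
Proof.
elim/groth_classW=> u; elim/groth_classW=> v.
rewrite [- groth_class v]groth_oppE [_ + _]groth_addE !K0_mapE.
rewrite [- groth_class _]groth_oppE [RHS]groth_addE.
by congr groth_class; rewrite /= !idemV_mapD.
Qed.

HB.instance Definition _ phi :=
  GRing.isAdditive.Build (K0 A) (K0 B) (K0_map phi) (K0_map_is_additive phi).

Lemma K0_map_class phi e : K0_map phi (K0_class e) = K0_class (idem_map phi e).
Proof. by rewrite K0_mapE /= idemV_mapE idemV_map0. Qed.

Lemma K0_map_unit phi : K0_map phi (K0_unit A) = K0_unit B.
Proof.
rewrite K0_map_class; congr K0_class.
apply: (@idempotent_ext _ (idem_map phi (Idempotent (idem1_subproof A)))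
          (Idempotent (idem1_subproof B)) erefl).
by rewrite castmx_id /= map_mx1.
Qed.

End K0Functoriality.

Lemma K0_mapK (A B : pzRingType) (phi : {rmorphism A -> B}) (psi : {rmorphism B -> A}) :
  cancel phi psi -> cancel (K0_map phi) (K0_map psi).
Proof.
move=> phiK.
have idemK x : idemV_map psi (idemV_map phi x) = x.
  elim/idem_classW: x => e; rewrite !idemV_mapE; congr idem_class.
  apply: (@idempotent_ext _ (idem_map psi (idem_map phi e)) e erefl).
  by rewrite castmx_id /=; apply/matrixP => i j; rewrite !mxE.
by elim/groth_classW=> -[u v]; rewrite !K0_mapE /= !idemK.
Qed.

(** K_0 is functorial for unital ring morphisms, and a surjective multiplicative
    map sends 1 to 1 because the image of 1 is neutral on its range. *)
Lemma ring_isomorphism_K0_triple_iso (A B : pzRingType) (phi : A -> B) :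
  bijective phi -> {morph phi : x y / x - y} -> {morph phi : x y / x * y} ->
  K0_triple_iso A B.
Proof.
move=> [psi phiK psiK] phiB phiM.
have phi1 : phi 1 = 1 by have := phiM 1 (psi 1); rewrite mul1r psiK mulr1.
have psiB : {morph psi : x y / x - y}.
  by move=> x y; rewrite -{1}[x]psiK -{1}[y]psiK -phiB phiK.
have psiM : {morph psi : x y / x * y}.
  by move=> x y; rewrite -{1}[x]psiK -{1}[y]psiK -phiM phiK.
have psi1 : psi 1 = 1 by rewrite -phi1 phiK.
pose phiA := GRing.isAdditive.Build _ _ phi phiB.
pose phiR := GRing.isMonoidMorphism.Build _ _ phi (conj phi1 phiM).
pose f : {rmorphism A -> B} := HB.pack phi phiA phiR.
pose psiA := GRing.isAdditive.Build _ _ psi psiB.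
pose psiR := GRing.isMonoidMorphism.Build _ _ psi (conj psi1 psiM).
pose g : {rmorphism B -> A} := HB.pack psi psiA psiR.
have fK : cancel (K0_map f) (K0_map g) by apply: K0_mapK => x; exact: phiK.
have gK : cancel (K0_map g) (K0_map f) by apply: K0_mapK => x; exact: psiK.
exists (K0_map f); split; first by exists (K0_map g).
  apply/seteqP; split=> [_ [_ [e _ <-] <-]|_ [e _ <-]].
    by exists (idem_map f e) => //; rewrite -K0_map_class.
  exists (K0_class (idem_map g e)); first by exists (idem_map g e).
  by apply: etrans (gK _); congr (K0_map f _); rewrite K0_map_class.
exact: K0_map_unit.
Qed.

(** * Divisibility of the unit class *)

Lemma groth_mulrn (M : nmodType) (u : M * M) n :
  groth_class u *+ n = groth_class (u.1 *+ n, u.2 *+ n).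
Proof.
elim: n => [//|n IHn]; rewrite [LHS]mulrSr IHn [LHS]groth_addE.
by congr groth_class; rewrite !mulrSr.
Qed.

Section ScalarIdempotents.
Variable A : pzRingType.
Implicit Types a b : A.

Lemma scalar_idem_subproof a : a * a = a ->
  (a%:M : 'M[A]_(1, 1)) *m a%:M = a%:M.
Proof. by move=> aa; rewrite -scalar_mxM aa. Qed.

Definition scalar_idem a (aa : a * a = a) : Defs.idempotent A :=
  Idempotent (scalar_idem_subproof aa).

Lemma scalar_idem_eqv a b (aa : a * a = a) (bb : b * b = b) x y :
  x * y = a -> y * x = b ->
  idem_class (scalar_idem aa) = idem_class (scalar_idem bb).
Proof.
move=> xy yx; apply/eqP/idem_classP; exists x%:M, y%:M.
by rewrite /= -!scalar_mxM xy yx.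
Qed.

(** The row (a b) and the column (a b) implement the equivalence of a + b with
    the block diagonal idempotent of a and b; orthogonality kills the off-diagonal
    blocks. *)
Lemma scalar_idem_orthD a b (aa : a * a = a) (bb : b * b = b)
    (ab : (a + b) * (a + b) = a + b) : a * b = 0 -> b * a = 0 ->
  idem_class (scalar_idem ab) = idem_class (scalar_idem aa) + idem_class (scalar_idem bb).
Proof.
move=> ab0 ba0; rewrite idem_class_sum; apply/eqP/idem_classP.
exists (row_mx a%:M b%:M), (col_mx a%:M b%:M).
rewrite /= mul_row_col mul_col_row -!scalar_mxM aa bb ab0 ba0 !raddf0.
by rewrite raddfD.
Qed.

Lemma scalar_idem_sum n (e : nat -> A) (P0 : e 0%N * e 0%N = e 0%N) :
  (forall i, (i < n)%N -> e i * e i = e i) ->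
  (forall i j, (i < n)%N -> (j < n)%N -> i != j -> e i * e j = 0) ->
  (forall i, (i < n)%N -> exists x y, x * y = e i /\ y * x = e 0%N) ->
  forall P : (\sum_(i < n) e i) * (\sum_(i < n) e i) = \sum_(i < n) e i,
  idem_class (scalar_idem P) = idem_class (scalar_idem P0) *+ n.
Proof.
elim: n => [|n IHn] ei eij exy.
  rewrite big_ord0 mulr0n => P; apply/eqP/idem_classP.
  by exists 0, 0; rewrite /= !mul0mx; split=> //; rewrite raddf0.
have sumM (m : nat) f : \sum_(i < m) e i * f = (\sum_(i < m) e i) * f by rewrite mulr_suml.
have Sn : (\sum_(i < n) e i) * e n = 0.
  by rewrite mulr_suml big1// => i _; rewrite eij ?ltn_eqF// ltnW ?ltnS.
have nS : e n * (\sum_(i < n) e i) = 0.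
  by rewrite mulr_sumr big1// => i _; rewrite eij ?gtn_eqF// ltnW ?ltnS.
rewrite big_ord_recr /= => P.
have Q : (\sum_(i < n) e i) * (\sum_(i < n) e i) = \sum_(i < n) e i.
  rewrite mulr_suml; apply: eq_bigr => i _; rewrite mulr_sumr (bigD1 i)//=.
  rewrite ei ?big1 ?addr0// => [j ji|]; last by rewrite ltnW ?ltnS.
  by rewrite eij// 1?eq_sym// ltnW ?ltnS.
rewrite (scalar_idem_orthD Q (ei n (ltnSn n)) _ Sn nS) mulrSr; congr (_ + _).
  by apply: IHn => [i h|i j h h'|i h]; [apply: ei|apply: eij|apply: exy]; exact: ltnW.
by have [x [y [xy yx]]] := exy n (ltnSn n); exact: scalar_idem_eqv xy yx.
Qed.

(** A partition of the unit into n mutually equivalent orthogonal idempotents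
    exhibits [1] as n times the class of one of them. *)
Lemma K0_unit_divisible n (e : nat -> A) : (0 < n)%N ->
  (forall i, (i < n)%N -> e i * e i = e i) ->
  (forall i j, (i < n)%N -> (j < n)%N -> i != j -> e i * e j = 0) ->
  (forall i, (i < n)%N -> exists x y, x * y = e i /\ y * x = e 0%N) ->
  \sum_(i < n) e i = 1 -> exists x : K0 A, K0_unit A = x *+ n.
Proof.
move=> n0 ei eij exy e1; exists (K0_class (scalar_idem (ei 0%N n0))).
have P : (\sum_(i < n) e i) * (\sum_(i < n) e i) = \sum_(i < n) e i.
  by rewrite e1 mulr1.
have := scalar_idem_sum (ei 0%N n0) ei eij exy P.
have -> : idem_class (scalar_idem P) = idem_class (Idempotent (idem1_subproof A)).
  apply/eqP/idem_classP; exists 1%:M, 1%:M.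
  by rewrite /= mul1mx e1.
move=> h; rewrite /K0_unit /K0_class h.
by rewrite groth_mulrn -[LHS]/(groth_class (_, _)) mul0rn.
Qed.

End ScalarIdempotents.

(** * Normed rings and matrices over them *)

Section RingNorm.
Context {R : realType}.

Record ring_norm (S : pzRingType) (nrm : S -> R) : Prop := RingNorm {
  rn0 : nrm 0 = 0;
  rn_eq0 : forall x, nrm x = 0 -> x = 0;
  rnN : forall x, nrm (- x) = nrm x;
  rnD : forall x y, nrm (x + y) <= nrm x + nrm y;
  rnM : forall x y, nrm (x * y) <= nrm x * nrm y }.

(** Convergence of geometrically fast Cauchy sequences is all that the Neumann
    series and the Newton iteration below require, and it passes to matrices
    entry by entry. *)
Definition ring_norm_complete (S : pzRingType) (nrm : S -> R) : Prop :=
  forall (u : nat -> S) c, (forall n, nrm (u n.+1 - u n) <= c * 2^-1 ^+ n) ->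
  exists l, forall e, 0 < e -> \forall n \near \oo, nrm (l - u n) < e.

(** The sum of the entry norms is submultiplicative for rectangular matrices of
    all sizes and additive on block diagonal sums. *)
Definition mxnrm (S : pzRingType) (nrm : S -> R) m n (M : 'M[S]_(m, n)) : R :=
  \sum_i \sum_j nrm (M i j).

Section MatrixNorm.
Variables (S : pzRingType) (nrm : S -> R).
Hypothesis nrmP : ring_norm nrm.
Local Notation mn := (mxnrm nrm).

Lemma rn_ge0 x : 0 <= nrm x.
Proof.
have := rnD nrmP x (- x); rewrite subrr (rn0 nrmP) (rnN nrmP).
by rewrite -mulr2n pmulrn_lge0.
Qed.

Lemma mxnrm_ge0 m n (M : 'M[S]_(m, n)) : 0 <= mn M.
Proof. by do 2!(apply: sumr_ge0 => ? _); exact: rn_ge0. Qed.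

Lemma mxnrm0 m n : mn ((0 : 'M[S]_(m, n))) = 0.
Proof. by rewrite /mxnrm !big1// => i _; rewrite big1// => j _; rewrite mxE (rn0 nrmP). Qed.

Lemma entry_le_mxnrm m n (M : 'M[S]_(m, n)) i j : nrm (M i j) <= mn M.
Proof.
rewrite /mxnrm (bigD1 i)//= (bigD1 j)//= -addrA lerDl addr_ge0//.
  by apply: sumr_ge0 => ? _; exact: rn_ge0.
by do 2!(apply: sumr_ge0 => ? _); exact: rn_ge0.
Qed.

Lemma mxnrm_eq0 m n (M : 'M[S]_(m, n)) : mn M = 0 -> M = 0.
Proof.
move=> M0; apply/matrixP => i j; rewrite mxE; apply: (rn_eq0 nrmP).
by apply/le_anti; rewrite rn_ge0 andbT -M0 entry_le_mxnrm.
Qed.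

Lemma mxnrmN m n (M : 'M[S]_(m, n)) : mn (- M) = mn M.
Proof. by do 2!(apply: eq_bigr => ? _); rewrite mxE (rnN nrmP). Qed.

Lemma mxnrmD m n (M N : 'M[S]_(m, n)) : mn (M + N) <= mn M + mn N.
Proof.
rewrite /mxnrm -big_split; apply: ler_sum => i _; rewrite -big_split.
by apply: ler_sum => j _; rewrite mxE (rnD nrmP).
Qed.

Lemma mxnrm_dist m n (M N : 'M[S]_(m, n)) : mn (M - N) = mn (N - M).
Proof. by rewrite -mxnrmN opprB. Qed.

Lemma rn_sum (I : Type) (r : seq I) (F : I -> S) :
  nrm (\sum_(i <- r) F i) <= \sum_(i <- r) nrm (F i).
Proof.
elim/big_rec2 : _ => [|i x y _ xy]; first by rewrite (rn0 nrmP).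
by apply: le_trans (rnD nrmP _ _) _; rewrite lerD2l.
Qed.

Lemma mxnrmM m n k (M : 'M[S]_(m, n)) (N : 'M[S]_(n, k)) : mn (M *m N) <= mn M * mn N.
Proof.
rewrite {2}/mxnrm mulr_suml; apply: ler_sum => i _.
rewrite mulr_suml; apply: le_trans (_ : \sum_j \sum_l nrm (M i j) * nrm (N j l) <= _).
  rewrite exchange_big; apply: ler_sum => l _; rewrite mxE.
  by apply: le_trans (rn_sum _ _) _; apply: ler_sum => j _; exact: rnM nrmP _ _.
apply: ler_sum => j _; rewrite -mulr_sumr ler_wpM2l ?rn_ge0//.
rewrite /mxnrm [leRHS](bigD1 j)//= lerDl.
by do 2!(apply: sumr_ge0 => ? _); exact: rn_ge0.
Qed.

Lemma mxnrm_block_diag m n k l (M : 'M[S]_(m, n)) (N : 'M[S]_(k, l)) :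
  mn (block_mx M 0 0 N) = mn M + mn N.
Proof.
rewrite /mxnrm big_split_ord/=; congr (_ + _); apply: eq_bigr => i _.
  rewrite big_split_ord/= [X in _ + X]big1 ?addr0; last first.
    by move=> j _; rewrite block_mxEur mxE (rn0 nrmP).
  by apply: eq_bigr => j _; rewrite block_mxEul.
rewrite big_split_ord/= [X in X + _]big1 ?add0r; last first.
  by move=> j _; rewrite block_mxEdl mxE (rn0 nrmP).
by apply: eq_bigr => j _; rewrite block_mxEdr.
Qed.

Lemma mxnrm_lt m n (M : 'M[S]_(m, n)) e : 0 < e ->
  (forall i j, nrm (M i j) < e / (m * n + 1)%:R) -> mn M < e.
Proof.
set d := e / _ => e0 Md.
have d0 : 0 < d by rewrite divr_gt0// ltr0n addn1.
apply: le_lt_trans (_ : \sum_(i < m) \sum_(j < n) d < e).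
  by apply: ler_sum => i _; apply: ler_sum => j _; exact: ltW.
rewrite !sumr_const !card_ord -mulrnA -mulr_natr /d -mulrA mulrC -ltr_pdivlMr//.
rewrite divff ?gt_eqF// mulrC ltr_pdivrMr ?ltr0n ?addn1// mul1r ltr_nat mulnC.
by rewrite ltnSn.
Qed.

Lemma mx_ring_norm n : ring_norm (mxnrm nrm (m := n) (n := n)).
Proof.
split; [exact: mxnrm0|exact: mxnrm_eq0|exact: mxnrmN|exact: mxnrmD|].
by move=> M N; exact: mxnrmM.
Qed.

Lemma mx_ring_norm_complete n : ring_norm_complete nrm ->
  ring_norm_complete (mxnrm nrm (m := n) (n := n)).
Proof.
move=> nrmC u c uc.
have H i j : exists l, forall e, 0 < e -> \forall n \near \oo, nrm (l - u n i j) < e.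
  apply: (nrmC (fun k => u k i j) c) => k; apply: le_trans (uc k).
  by have := entry_le_mxnrm (u k.+1 - u k) i j; rewrite !mxE.
have [l lP] : exists l : 'M[S]_n, forall i j e, 0 < e ->
    \forall n \near \oo, nrm (l i j - u n i j) < e.
  exists (\matrix_(i, j) projT1 (cid (H i j))) => i j.
  by rewrite mxE; exact: projT2 (cid (H i j)).
exists l => e e0.
have d0 : 0 < e / (n * n + 1)%:R by rewrite divr_gt0// ltr0n addn1.
have K : \forall k \near \oo, forall ij : 'I_n * 'I_n,
    nrm (l ij.1 ij.2 - u k ij.1 ij.2) < e / (n * n + 1)%:R.
  by apply: filter_forall => -[i j] /=; exact: lP.
near=> k; apply: mxnrm_lt => // i j; rewrite !mxE.
have Kk : forall ij : 'I_n * 'I_n,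
    nrm (l ij.1 ij.2 - u k ij.1 ij.2) < e / (n * n + 1)%:R by near: k.
exact: (Kk (i, j)).
Unshelve. all: by end_near. Qed.

End MatrixNorm.
End RingNorm.


(** * Perturbation of idempotents *)

Section Perturbation.
Context {R : realType}.

Lemma half_pow_lt (e : R) : 0 < e -> \forall n \near \oo, 2^-1 ^+ n < e.
Proof.
move=> e0; have h : `|2^-1 : R| < 1 by rewrite ger0_norm ?invr_ge0// invf_lt1// ltr1n.
have /cvgr0_norm_lt/(_ e e0) := cvg_expr h.
by apply: filterS => n /=; rewrite ger0_norm// exprn_ge0// invr_ge0.
Qed.

Section CompleteRing.
Variables (S : pzRingType) (nrm : S -> R).
Hypotheses (nrmP : ring_norm nrm) (nrmC : ring_norm_complete nrm).

Lemma rnB x y : nrm (x - y) <= nrm x + nrm y.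
Proof. by rewrite -(rnN nrmP y) (rnD nrmP). Qed.

Lemma rn_natmul x n : nrm (x *+ n) <= nrm x *+ n.
Proof.
elim: n => [|n IHn]; first by rewrite !mulr0n (rn0 nrmP).
by rewrite !mulrS (le_trans (rnD nrmP _ _))// lerD2l.
Qed.

(** The bound on the distance to the first term does not depend on the constants
    by which the norm of a matrix ring dominates its entries. *)
Lemma geometric_limit (u : nat -> S) c :
  (forall n, nrm (u n.+1 - u n) <= c * 2^-1 ^+ n) ->
  exists2 l, nrm (l - u 0%N) <= 2 * c &
    forall e, 0 < e -> \forall n \near \oo, nrm (l - u n) < e.
Proof.
move=> uc; have [l lP] := nrmC uc; exists l => //.
have un n : nrm (u n - u 0%N) <= 2 * c * (1 - 2^-1 ^+ n).
  elim: n => [|n IHn]; first by rewrite subrr (rn0 nrmP) expr0 subrr mulr0.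
  rewrite -(subrKA (u n)) addrC; apply: le_trans (rnD nrmP _ _) _.
  apply: le_trans (lerD IHn (uc n)) _.
  by rewrite exprS; lra.
have c0 : 0 <= c by have := le_trans (rn_ge0 nrmP _) (uc 0%N); rewrite expr0 mulr1.
apply/ler_addgt0Pl => e e0.
near \oo => n.
rewrite -(subrKA (u n)); apply: le_trans (rnD nrmP _ _) _.
apply: lerD; first by apply: ltW; near: n; exact: lP.
apply: le_trans (un n) _; rewrite -[leRHS]mulr1 ler_wpM2l ?mulr_ge0 ?lerBlDr ?lerDl ?exprn_ge0 ?invr_ge0//.
Unshelve. all: by end_near. Qed.

Lemma rn_small0 x : (forall e, 0 < e -> nrm x <= e) -> x = 0.
Proof.
move=> h; apply: (rn_eq0 nrmP); apply/le_anti; rewrite (rn_ge0 nrmP) andbT.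
by apply/ler_addgt0Pl => e e0; rewrite addr0 h.
Qed.

(** Neumann series. *)
Lemma near_one_invertible w : nrm (1 - w) <= 2^-1 ->
  exists2 v, v * w = 1 & w * v = 1.
Proof.
set x := 1 - w => x2.
have xn n : nrm (x ^+ n) <= nrm 1 * 2^-1 ^+ n.
  elim: n => [|n IHn]; first by rewrite !expr0 mulr1.
  rewrite exprS exprS mulrCA (le_trans (rnM nrmP _ _))//.
  by rewrite ler_pM ?(rn_ge0 nrmP).
pose s n : S := \sum_(i < n) x ^+ i.
have sS n : nrm (s n.+1 - s n) <= nrm 1 * 2^-1 ^+ n.
  by rewrite /s big_ord_recr /= addrAC subrr add0r.
have [v _ vP] := geometric_limit sS.
have wx : w = 1 - x by rewrite /x opprB addrC subrK.
have ws n : w * s n = 1 - x ^+ n.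
  by rewrite -[RHS]opprB subrX1 -mulNr opprB -wx.
have sw n : s n * w = 1 - x ^+ n.
  rewrite -ws wx mulrBl mulrBr mul1r mulr1; congr (_ - _).
  by rewrite mulr_suml mulr_sumr; apply: eq_bigr => i _; rewrite -exprS -exprSr.
have lim0 e : 0 < e -> \forall n \near \oo, nrm (x ^+ n) < e.
  move=> e0; have n0 : 0 < nrm 1 + 1 by rewrite ltr_wpDl ?(rn_ge0 nrmP).
  near=> n; apply: le_lt_trans (xn n) _.
  apply: (@le_lt_trans _ _ ((nrm 1 + 1) * 2^-1 ^+ n)).
    by rewrite ler_wpM2r ?exprn_ge0 ?invr_ge0// lerDl.
  rewrite mulrC -ltr_pdivlMr//.
  by near: n; apply: half_pow_lt; rewrite divr_gt0.
have aux y : (forall n, nrm (y - 1) <= nrm (v - s n) * nrm w + nrm (x ^+ n)) -> y = 1.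
  move=> h; apply/eqP; rewrite -subr_eq0; apply/eqP/rn_small0 => e e0.
  have w0 : 0 < nrm w + 1 by rewrite ltr_wpDl ?(rn_ge0 nrmP).
  have e1 : 0 < e / 2 / (nrm w + 1) by rewrite !divr_gt0.
  have e2 : 0 < e / 2 by rewrite divr_gt0.
  near \oo => n; apply: le_trans (h n) _; rewrite [leRHS](splitr e) lerD//.
    apply: (@le_trans _ _ (nrm (v - s n) * (nrm w + 1))).
      by rewrite ler_wpM2l ?(rn_ge0 nrmP)// lerDl.
    by rewrite -ler_pdivlMr// ltW//; near: n; exact: vP.
  by apply: ltW; near: n; exact: lim0.
exists v; apply: aux => n.
  have -> : v * w - 1 = (v - s n) * w - x ^+ n.
    by rewrite mulrBl sw opprB addrA addrAC addrK addrC.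
  by apply: le_trans (rnB _ _) _; rewrite lerD2r (rnM nrmP).
have -> : w * v - 1 = w * (v - s n) - x ^+ n.
  by rewrite mulrBr ws opprB addrA addrAC addrK addrC.
by apply: le_trans (rnB _ _) _; rewrite lerD2r mulrC (rnM nrmP).
Unshelve. all: by end_near. Qed.

End CompleteRing.

(** Here d is the idempotency defect of a, and s = 2 a - 1 is an approximate
    symmetry; the identity eliminates the powers of s from a Newton step. *)
Lemma newton_sym_sqr (S : pzRingType) (a d s : S) :
  a * a = a + d -> s + 1 = a + a -> s * s = 1 + d *+ 4.
Proof.
move=> aa s1; apply: (@addIr _ (s + s + 1)).
transitivity ((s + 1) * (s + 1)).
  by rewrite mulrDl !mulrDr !mulr1 !mul1r !addrA.
rewrite {1}s1 s1 mulrDl !mulrDr !aa.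
transitivity ((a + a) + (a + a) + d *+ 4).
  by rewrite !mulrS mulr0n addr0 [LHS](AC ((2*2)*(2*2)) ((1*3*(5*7))*(2*(4*(6*8))))).
by rewrite -s1 [LHS](AC ((2*2)*1) ((2*5)*((1*3)*4))).
Qed.

(** One Newton step b = 3 a^2 - 2 a^3, written a - (2 a - 1) d, replaces the
    defect d by 4 d^3 - 3 d^2: convergence is quadratic. *)
Lemma newton_defect (S : pzRingType) (a d s b : S) :
  a * a = a + d -> s + 1 = a + a -> b = a - s * d ->
  b * b - b = d * d * d *+ 4 - d * d *+ 3.
Proof.
move=> aa s1 bE.
have ss := newton_sym_sqr aa s1.
have ad : a * d = d * a.
  by apply: (@addrI _ (a * a)); rewrite -mulrDr -mulrDl -aa mulrA.
have sE : s = a + a - 1 by rewrite -s1 addrK.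
have sd : s * d = d * s by rewrite sE mulrBl mulrBr mulrDl mulrDr ad mulr1 mul1r.
have sa : s * a = a * s by rewrite sE mulrBl mulrBr mulrDl mulrDr mulr1 mul1r.
set t := s * d.
have att : a * t + t * a = s * t + t.
  have -> : t * a = a * t by rewrite /t -mulrA -ad mulrA sa mulrA.
  by rewrite -{4}[t]mul1r -!mulrDl s1.
have st : s * t = d + d * d *+ 4 by rewrite /t mulrA ss mulrDl mul1r mulrnAl.
have tt : t * t = d * d + d * d * d *+ 4.
  by rewrite {1}/t sd -mulrA st mulrDr mulrnAr mulrA.
have -> : b * b = a + d - (s * t + t) + t * t.
  rewrite bE -/t mulrBl !mulrBr aa -att !opprD !opprK.
  by rewrite !addrA.
rewrite st tt bE -/t !opprD opprK.
rewrite [LHS](AC (2*((1*(1*(1*2)))*1)*2*2) ((1*11)*(2*3)*(8*12)*(4*9)*(10*(5*(6*7))))).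
by rewrite /= !subrr !addNr !add0r.
Qed.

Section IdempotentPerturbation.
Variables (S : pzRingType) (nrm : S -> R).
Hypotheses (nrmP : ring_norm nrm) (nrmC : ring_norm_complete nrm).

(** The defect at least halves at each Newton step, and 2 a - 1 grows by at most
    the factor 1 + 2 |d|, so it stays below 2 L; the steps are therefore summable.
    The final distance is proportional to the initial defect, with a factor that
    depends on the norm of 2 a - 1 alone. *)
Lemma near_idempotent a (L : R) : nrm (a + a - 1) <= L -> nrm (a * a - a) <= 8^-1 ->
  exists2 q, q * q = q & nrm (q - a) <= 4 * L * nrm (a * a - a).
Proof.
move=> aL; set delta := nrm (a * a - a) => d8.
pose b n : S := iter n (fun a => a - (a + a - 1) * (a * a - a)) a.
pose d n := b n * b n - b n; pose s n := b n + b n - 1.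
have bS n : b n.+1 = b n - s n * d n by [].
have hd n : d n.+1 = d n * d n * d n *+ 4 - d n * d n *+ 3.
  by apply: (@newton_defect _ (b n) (d n) (s n)); rewrite // ?/d ?/s ?subrK// addrC subrK.
have hs n : s n.+1 = s n - (s n * d n) *+ 2.
  rewrite {1}/s bS mulr2n opprD /s.
  by rewrite [LHS](AC ((2*2)*1) ((1*3*5)*(2*4))).
have d0 : 0 <= delta by exact: rn_ge0.
have dn n : nrm (d n) <= delta * 2^-1 ^+ n.
  elim: n => [|n IHn]; first by rewrite expr0 mulr1.
  have dn8 : nrm (d n) <= 8^-1.
    apply: le_trans IHn _; apply: le_trans d8; rewrite -[leRHS]mulr1 ler_wpM2l//.
    by rewrite exprn_ile1 ?invr_ge0// invf_le1// ler1n.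
  have dn0 : 0 <= nrm (d n) by exact: rn_ge0.
  rewrite exprSr mulrA; apply: le_trans (_ : nrm (d n) * 2^-1 <= _); last first.
    by rewrite ler_wpM2r ?invr_ge0.
  rewrite hd; apply: le_trans (rnB nrmP _ _) _.
  apply: le_trans (lerD (rn_natmul nrmP _ _) (rn_natmul nrmP _ _)) _.
  (* |4 d^3 - 3 d^2| <= (4/8 + 3) |d| |d| <= (7/16) |d| *)
  have dd : nrm (d n * d n) <= nrm (d n) * nrm (d n) := rnM nrmP _ _.
  have ddd : nrm (d n * d n * d n) <= nrm (d n) * nrm (d n) * nrm (d n).
    by apply: le_trans (rnM nrmP _ _) _; rewrite ler_wpM2r.
  move: (nrm (d n)) (nrm (d n * d n)) (nrm (d n * d n * d n)) dn0 dn8 dd ddd => x y z *.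
  nra.
have L0 : 0 <= L := le_trans (rn_ge0 nrmP _) aL.
have sn n : nrm (s n) <= L * (2 - 2^-1 ^+ n).
  elim: n => [|n IHn]; first by rewrite expr0; have -> : L * (2 - 1) = L by ring.
  rewrite hs; apply: le_trans (rnB nrmP _ _) _.
  have sd2 : nrm (s n * d n *+ 2) <= nrm (s n) * nrm (d n) * 2.
    apply: le_trans (rn_natmul nrmP _ _) _.
    by rewrite -[leLHS]mulr_natr ler_wpM2r// (rnM nrmP).
  apply: (@le_trans _ _ (nrm (s n) + nrm (s n) * nrm (d n) * 2)).
    by rewrite lerD2l.
  have h0 : 0 <= 2^-1 ^+ n :> R by rewrite exprn_ge0 ?invr_ge0.
  have x0 : 0 <= nrm (s n) by exact: rn_ge0.
  have y0 : 0 <= nrm (d n) by exact: rn_ge0.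
  have := dn n; rewrite exprSr; move: (2^-1 ^+ n) h0 IHn sd2 => h h0 xL z2 yd.
  have yh : nrm (d n) <= h / 8 by apply: le_trans yd _; rewrite mulrC ler_wpM2l.
  have x2 : nrm (s n) <= 2 * L by apply: le_trans xL _; nra.
  have xy : nrm (s n) * nrm (d n) <= 2 * L * (h / 8) by rewrite ler_pM.
  lra.
have bn n : nrm (b n.+1 - b n) <= 2 * L * delta * 2^-1 ^+ n.
  rewrite bS addrAC subrr add0r (rnN nrmP); apply: le_trans (rnM nrmP _ _) _.
  rewrite -mulrA ler_pM ?(rn_ge0 nrmP)//; apply: le_trans (sn n) _.
  by rewrite [leRHS]mulrC ler_wpM2l// gerBl exprn_ge0 ?invr_ge0.
have [q q0 qP] := geometric_limit nrmP nrmC bn.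
exists q; last by apply: le_trans q0 _; rewrite le_eqVlt; apply/orP; left; apply/eqP; ring.
apply/eqP; rewrite -subr_eq0; apply/eqP/(rn_small0 nrmP) => e e0.
pose K := nrm q + (nrm q + 1) + 1 + 1.
have qq0 : 0 <= nrm q by exact: rn_ge0.
have K0 : 0 < K by rewrite /K; lra.
have eK : 0 < e / K by rewrite divr_gt0.
near \oo => n.
have h1 : nrm (q - b n) < e / K by near: n; exact: qP.
have h2 : nrm (q - b n) < 1 by near: n; exact: qP.
have h3 : nrm (d n) <= e / K.
  apply: le_trans (dn n) _; apply: le_trans (_ : 2^-1 ^+ n <= _).
    rewrite -[leRHS]mul1r ler_wpM2r ?exprn_ge0 ?invr_ge0//.
    by apply: le_trans d8 _; rewrite invf_le1// ler1n.
  by apply: ltW; near: n; exact: half_pow_lt.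
have bq : nrm (b n) <= nrm q + 1.
  rewrite (_ : b n = q - (q - b n)); last by rewrite opprB addrC subrK.
  by apply: le_trans (rnB nrmP _ _) _; rewrite lerD2l ltW.
have -> : q * q - q = (q - b n) * q + b n * (q - b n) - (q - b n) + d n.
  rewrite /d mulrBl mulrBr opprB.
  rewrite [RHS](AC (2*2*2*2) ((1*5*((2*3)*((4*7)*(6*8)))))) /=.
  by rewrite !addNr !add0r addrACA subrr addr0.
apply: le_trans (rnD nrmP _ _) _.
apply: le_trans (lerD (le_trans (rnB nrmP _ _) (lerD (rnD nrmP _ _) (lexx _))) (lexx _)) _.
have m1 : nrm ((q - b n) * q) <= e / K * nrm q.
  by apply: le_trans (rnM nrmP _ _) _; rewrite ler_wpM2r// ltW.
have m2 : nrm (b n * (q - b n)) <= e / K * (nrm q + 1).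
  apply: le_trans (rnM nrmP _ _) _.
  by rewrite [leLHS]mulrC ler_pM ?(rn_ge0 nrmP)// ltW.
have -> : e = e / K * nrm q + e / K * (nrm q + 1) + e / K + e / K.
  by rewrite -{3 4}[e / K]mulr1 -!mulrDr -/K divfK ?gt_eqF.
by rewrite !lerD// ltW.
Unshelve. all: by end_near. Qed.

(** The elements X = q x r and Z = r y q have products XZ and ZX close to q and
    r, hence invertible in the corners cut out by q and r.  The right inverse of X
    in the first corner and the left inverse in the second then coincide. *)
Lemma near_equivalence m n (q : 'M[S]_m) (r : 'M[S]_n) (x : 'M[S]_(m, n)) (y : 'M[S]_(n, m)) :
  q *m q = q -> r *m r = r ->
  mxnrm nrm (q - (q *m x *m r) *m (r *m y *m q)) <= 2^-1 ->
  mxnrm nrm (r - (r *m y *m q) *m (q *m x *m r)) <= 2^-1 ->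
  exists X Y, X *m Y = q /\ Y *m X = r.
Proof.
move=> qq rr; set X := q *m x *m r; set Z := r *m y *m q => hq hr.
have qX : q *m X = X by rewrite /X !mulmxA qq.
have Xr : X *m r = X by rewrite /X -mulmxA rr.
have rZ : r *m Z = Z by rewrite /Z !mulmxA rr.
have Zq : Z *m q = Z by rewrite /Z -mulmxA qq.
clearbody X Z.
(* adding the complement 1 - a turns invertibility of b in the corner of a into
   invertibility in the whole matrix ring *)
have inv k (a b : 'M[S]_k) : a *m a = a -> a *m b = b -> b *m a = b ->
    mxnrm nrm (a - b) <= 2^-1 ->
    exists c : 'M[S]_k, [/\ b *m c = a, c *m b = a & a *m c = c *m a].
  move=> aa ab ba h.
  have [|c cw wc] := @near_one_invertible _ _ (mx_ring_norm nrmP k)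
      (mx_ring_norm_complete nrmP (n := k) nrmC) (1 - a + b : 'M[S]_k).
    by rewrite opprD opprB addrA subrKC.
  have aw : a *m (1 - a + b) = b by rewrite mulmxDr mulmxBr mulmx1 aa subrr add0r.
  have wa : (1 - a + b) *m a = b by rewrite mulmxDl mulmxBl mul1mx aa subrr add0r.
  have {}cw : c *m (1 - a + b) = 1%:M := cw.
  have {}wc : (1 - a + b) *m c = 1%:M := wc.
  exists c; split.
  - by rewrite -aw -mulmxA wc mulmx1.
  - by rewrite -wa mulmxA cw mul1mx.
  - rewrite -[LHS]mul1mx -cw -mulmxA [_ *m (a *m c)]mulmxA wa -aw.
    by rewrite -!mulmxA wc mulmx1.
have [|||c [_ cb ac]] := inv _ r (Z *m X) rr.
- by rewrite mulmxA rZ.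
- by rewrite -mulmxA Xr.
- exact: hr.
have [|||d [bd _ dq]] := inv _ q (X *m Z) qq.
- by rewrite mulmxA qX.
- by rewrite -mulmxA Zq.
- exact: hq.
exists X, (Z *m d); split; first by rewrite mulmxA.
have ZdE : Z *m d = c *m Z.
  have cZX : c *m Z *m X = r by rewrite -mulmxA.
  have -> : c *m Z = c *m Z *m (X *m Z *m d) by rewrite bd -mulmxA Zq.
  by rewrite !mulmxA cZX rZ.
by rewrite ZdE -mulmxA.
Qed.

End IdempotentPerturbation.
End Perturbation.


(** * Asymptotically multiplicative maps and divisibility in K_0 *)

Section Asymptotic.
Context {R : realType} {K : numDomainType}.
Variables (A : pzRingType) (nA : A -> R).
Variables (S : nat -> pzRingType) (nS : forall m, S m -> R).
Variable phi : forall m, {additive A -> S m}.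
Variables (tau : forall m, {additive S m -> K}) (N : nat -> nat).
Hypotheses (nSP : forall m, ring_norm (@nS m)) (nSC : forall m, ring_norm_complete (@nS m)).
Hypothesis phi_contractive : forall m a, nS (phi m a) <= nA a.
Hypothesis phi1 : forall m, phi m 1 = 1.
Hypothesis phiM : forall a b e, 0 < e ->
  \forall m \near \oo, nS (phi m (a * b) - phi m a * phi m b) < e.
Hypothesis tauC : forall m a b, tau m (a * b) = tau m (b * a).
Hypothesis tau1 : forall m, tau m 1 = (N m)%:R.
Hypothesis tau_idem : forall m k (Q : 'M[S m]_k), Q *m Q = Q ->
  exists n : nat, \sum_i tau m (Q i i) = n%:R.

Local Notation mxseq k l := (forall m, 'M[S m]_(k, l)).

Definition mxseq_null k l (U : mxseq k l) :=
  forall e, 0 < e -> \forall m \near \oo, mxnrm (@nS m) (U m) < e.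

Definition mxseq_bounded k l (U : mxseq k l) :=
  exists c, \forall m \near \oo, mxnrm (@nS m) (U m) <= c.

(** Sequences of matrices, the m-th one over S m, are compared modulo those whose
    norms tend to 0; on bounded sequences this congruence respects products. *)
Definition mxseq_asymp k l (U V : mxseq k l) :=
  mxseq_null (fun m => U m - V m).

Lemma mxseq_nullD k l (U V : mxseq k l) :
  mxseq_null U -> mxseq_null V -> mxseq_null (fun m => U m + V m).
Proof.
move=> U0 V0 e e0; have e2 : 0 < e / 2 by rewrite divr_gt0.
near=> m; apply: le_lt_trans (mxnrmD (nSP m) _ _) _.
by rewrite [ltRHS]splitr ltrD//; near: m; [exact: U0|exact: V0].
Unshelve. all: by end_near. Qed.

Lemma mxseq_nullM k l n (U : mxseq k l) (V : mxseq l n) :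
  mxseq_bounded U -> mxseq_null V -> mxseq_null (fun m => U m *m V m).
Proof.
move=> [c Uc] V0 e e0; have c0 : 0 < `|c| + 1 by rewrite ltr_wpDl.
have ec : 0 < e / (`|c| + 1) by rewrite divr_gt0.
near=> m; apply: le_lt_trans (mxnrmM (nSP m) _ _) _.
apply: le_lt_trans (_ : (`|c| + 1) * mxnrm (@nS m) (V m) < _).
  rewrite ler_wpM2r ?mxnrm_ge0//; apply: (@le_trans _ _ c).
    by near: m.
  by apply: le_trans (ler_norm _) _; rewrite lerDl.
by rewrite mulrC -ltr_pdivlMr//; near: m; exact: V0.
Unshelve. all: by end_near. Qed.

Lemma mxseq_nullMr k l n (U : mxseq k l) (V : mxseq l n) :
  mxseq_null U -> mxseq_bounded V -> mxseq_null (fun m => U m *m V m).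
Proof.
move=> U0 [c Vc] e e0; have c0 : 0 < `|c| + 1 by rewrite ltr_wpDl.
have ec : 0 < e / (`|c| + 1) by rewrite divr_gt0.
near=> m; apply: le_lt_trans (mxnrmM (nSP m) _ _) _.
apply: le_lt_trans (_ : mxnrm (@nS m) (U m) * (`|c| + 1) < _).
  rewrite ler_wpM2l ?mxnrm_ge0//; apply: (@le_trans _ _ c).
    by near: m.
  by apply: le_trans (ler_norm _) _; rewrite lerDl.
by rewrite -ltr_pdivlMr//; near: m; exact: U0.
Unshelve. all: by end_near. Qed.

Lemma mxseq_asymp_sym k l (U V : mxseq k l) : mxseq_asymp U V -> mxseq_asymp V U.
Proof.
move=> UV e /UV; apply: filterS => m.
by rewrite mxnrm_dist.
Qed.

Lemma mxseq_asymp_trans k l (V U W : mxseq k l) :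
  mxseq_asymp U V -> mxseq_asymp V W -> mxseq_asymp U W.
Proof.
move=> UV VW e e0; have := mxseq_nullD UV VW e0; apply: filterS => m.
by rewrite subrKA.
Qed.

Lemma mxseq_asymp_bounded k l (U V : mxseq k l) :
  mxseq_asymp U V -> mxseq_bounded V -> mxseq_bounded U.
Proof.
move=> UV [c Vc]; exists (1 + c); near=> m.
rewrite -[U m](subrK (V m)); apply: le_trans (mxnrmD (nSP m) _ _) _.
apply: lerD; last by near: m.
by apply: ltW; near: m; exact: UV.
Unshelve. all: by end_near. Qed.

Lemma mxseq_asympM k l n (U U' : mxseq k l) (V V' : mxseq l n) :
  mxseq_bounded U' -> mxseq_bounded V' ->
  mxseq_asymp U U' -> mxseq_asymp V V' ->
  mxseq_asymp (fun m => U m *m V m) (fun m => U' m *m V' m).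
Proof.
move=> bU' bV' UU' VV'; have bU := mxseq_asymp_bounded UU' bU'.
have h := mxseq_nullD (mxseq_nullM bU VV') (mxseq_nullMr UU' bV').
move=> e /h; apply: filterS => m.
by rewrite mulmxBr mulmxBl subrKA.
Qed.

Definition phi_mx k l (M : 'M[A]_(k, l)) : mxseq k l := fun m => map_mx (phi m) M.

Lemma mxnrm_phi k l (M : 'M[A]_(k, l)) m : mxnrm (@nS m) (phi_mx M m) <= mxnrm nA M.
Proof. by do 2!(apply: ler_sum => ? _); rewrite mxE. Qed.

Lemma phi_mx_bounded k l (M : 'M[A]_(k, l)) : mxseq_bounded (phi_mx M).
Proof. by exists (mxnrm nA M); near=> m; exact: mxnrm_phi.
Unshelve. all: by end_near. Qed.

Lemma phi_mxM k l n (M : 'M[A]_(k, l)) (M' : 'M[A]_(l, n)) :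
  mxseq_asymp (phi_mx (M *m M')) (fun m => phi_mx M m *m phi_mx M' m).
Proof.
move=> e e0.
have d0 : 0 < e / (k * n + 1)%:R / (l + 1)%:R by rewrite !divr_gt0// ltr0n addn1.
have H : \forall m \near \oo, forall ijh : 'I_k * 'I_n * 'I_l,
   nS (phi m (M ijh.1.1 ijh.2 * M' ijh.2 ijh.1.2)
     - phi m (M ijh.1.1 ijh.2) * phi m (M' ijh.2 ijh.1.2)) < e / (k * n + 1)%:R / (l + 1)%:R.
  by apply: filter_forall => ijh; exact: phiM.
near=> m; apply: (mxnrm_lt e0) => i j.
have Hm : forall ijh : 'I_k * 'I_n * 'I_l,
   nS (phi m (M ijh.1.1 ijh.2 * M' ijh.2 ijh.1.2)
     - phi m (M ijh.1.1 ijh.2) * phi m (M' ijh.2 ijh.1.2)) < e / (k * n + 1)%:R / (l + 1)%:R.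
  by near: m.
rewrite !mxE raddf_sum -sumrB.
apply: le_lt_trans (rn_sum (nSP m) _ _) _.
apply: le_lt_trans (_ : \sum_(h < l) (e / (k * n + 1)%:R / (l + 1)%:R) < _).
  by apply: ler_sum => h _; rewrite !mxE ltW//; exact: (Hm (i, j, h)).
rewrite sumr_const card_ord -[ltLHS]mulr_natr mulrAC ltr_pdivrMr ?ltr0n ?addn1//.
by rewrite ltr_pM2l ?ltr_nat// divr_gt0// ltr0n addn1.
Unshelve. all: by end_near. Qed.

(** The maps phi m are only asymptotically multiplicative, so they do not send
    idempotents to idempotents; a sequence of genuine idempotents asymptotic to
    the images takes the place of the image. *)
Definition tracks (e : Defs.idempotent A) (q : mxseq (idem_dim e) (idem_dim e)) :=
  (forall m, q m *m q m = q m) /\ mxseq_asymp q (phi_mx e).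

(** Newton iteration applies for large m.  The bound L on 2 F - 1 is uniform in m
    because phi m is contractive and unital. *)
Lemma tracks_exists (e : Defs.idempotent A) : exists q, @tracks e q.
Proof.
pose F := phi_mx e.
pose L := mxnrm nA e + mxnrm nA e + mxnrm nA (1%:M : 'M[A]_(idem_dim e)).
have H m : exists q : 'M[S m]_(idem_dim e), q *m q = q /\
    (mxnrm (@nS m) (F m *m F m - F m) <= 8^-1 ->
     mxnrm (@nS m) (q - F m) <= 4 * L * mxnrm (@nS m) (F m *m F m - F m)).
  have [h|h] := leP (mxnrm (@nS m) (F m *m F m - F m)) 8^-1; last first.
    (* before the defect is small, any idempotent will do *)
    by exists 0; rewrite mul0mx; split=> //.
  have P := mx_ring_norm (nSP m) (idem_dim e).
  have FL : mxnrm (@nS m) (F m + F m - 1) <= L.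
    apply: le_trans (rnB P _ _) _; rewrite lerD//.
      by apply: le_trans (rnD P _ _) _; rewrite lerD// mxnrm_phi.
    have -> : 1 = phi_mx (1%:M : 'M[A]_(idem_dim e)) m :> 'M[S m]_(idem_dim e).
      by apply/matrixP => i j; rewrite !mxE raddfMn phi1.
    exact: mxnrm_phi.
  have [q qq qF] := near_idempotent P (mx_ring_norm_complete (nSP m) (n := idem_dim e) (@nSC m)) FL h.
  by exists q.
pose q m := projT1 (cid (H m)).
have [qq qF] := all_and2 (fun m => projT2 (cid (H m))).
exists q; split=> // e' e0.
have FF : mxseq_null (fun m => F m *m F m - F m).
  apply: mxseq_asymp_sym; have := @phi_mxM _ _ _ (idem_mx e) (idem_mx e).
  by rewrite idem_mxP.
have L0 : 0 < 4 * `|L| + 1 by rewrite ltr_wpDl ?mulr_ge0.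
have e1 : 0 < e' / (4 * `|L| + 1) by rewrite divr_gt0.
have e2 : 0 < 8^-1 :> R by rewrite invr_gt0.
near=> m; apply: le_lt_trans (qF m _) _; first by apply: ltW; near: m; exact: FF.
apply: (@le_lt_trans _ _ ((4 * `|L| + 1) * mxnrm (@nS m) (F m *m F m - F m))).
  rewrite ler_wpM2r ?mxnrm_ge0//; apply: (@le_trans _ _ (4 * `|L|)); last by rewrite lerDl.
  by rewrite ler_wpM2l// ler_norm.
by rewrite mulrC -ltr_pdivlMr//; near: m; exact: FF.
Unshelve. all: by end_near. Qed.

(** If x y = e and y x = f then e x f y e = e, and both sides can be replaced by
    their images up to a null sequence. *)
Lemma tracks_corner (e f : Defs.idempotent A) q r
    (x : 'M[A]_(idem_dim e, idem_dim f)) (y : 'M[A]_(idem_dim f, idem_dim e)) :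
  @tracks e q -> @tracks f r -> x *m y = idem_mx e -> y *m x = idem_mx f ->
  mxseq_asymp q (fun m => (q m *m phi_mx x m *m r m) *m (r m *m phi_mx y m *m q m)).
Proof.
move=> [qq qe] [rr rf] xy yx.
have b k l (M : 'M[A]_(k, l)) := phi_mx_bounded M.
have step k l n (U : mxseq k l) (V : mxseq l n) M M' :
    mxseq_asymp U (phi_mx M) -> mxseq_asymp V (phi_mx M') ->
    mxseq_asymp (fun m => U m *m V m) (phi_mx (M *m M')).
  move=> UM VM; apply: mxseq_asymp_trans (mxseq_asympM (b _ _ M) (b _ _ M') UM VM) _.
  exact/mxseq_asymp_sym/phi_mxM.
have refl k l (M : 'M[A]_(k, l)) : mxseq_asymp (phi_mx M) (phi_mx M).
  by move=> e' e0; near=> m; rewrite subrr mxnrm0.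
apply: (mxseq_asymp_trans qe); apply: mxseq_asymp_sym.
have -> : idem_mx e = (idem_mx e *m x *m idem_mx f) *m (idem_mx f *m y *m idem_mx e).
  have ex : idem_mx e *m x = x *m idem_mx f by rewrite -xy -yx mulmxA.
  have ey : y *m idem_mx e = idem_mx f *m y by rewrite -xy -yx mulmxA.
  rewrite ex -[x *m _ *m _]mulmxA idem_mxP -[_ *m y *m _]mulmxA ey mulmxA.
  rewrite -[x *m _ *m _]mulmxA idem_mxP -ex -mulmxA -ey.
  by rewrite !mulmxA -[_ *m x *m y]mulmxA xy !idem_mxP.
have qxr := step _ _ _ _ r _ (idem_mx f) (step _ _ _ q (phi_mx x) (idem_mx e) x qe (refl _ _ x)) rf.
have ryq := step _ _ _ _ q _ (idem_mx e) (step _ _ _ r (phi_mx y) (idem_mx f) y rf (refl _ _ y)) qe.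
exact: step _ _ _ _ _ _ _ qxr ryq.
Unshelve. all: by end_near. Qed.

Lemma tracks_equivalent (e f : Defs.idempotent A) q r :
  @tracks e q -> @tracks f r -> idem_class e = idem_class f ->
  \forall m \near \oo, exists X Y, X *m Y = q m /\ Y *m X = r m.
Proof.
move=> tq tr /eqP/idem_classP[x [y [xy yx]]].
have h1 := tracks_corner tq tr xy yx; have h2 := tracks_corner tr tq yx xy.
have d0 : 0 < 2^-1 :> R by rewrite invr_gt0.
near=> m; apply: (@near_equivalence _ _ _ (nSP m) (@nSC m) _ _ _ _ (phi_mx x m) (phi_mx y m)).
- by case: tq.
- by case: tr.
- by apply: ltW; near: m; exact: h1.
- by apply: ltW; near: m; exact: h2.
Unshelve. all: by end_near. Qed.

(** t m is the rank of an idempotent near the image of e under phi m; it is well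
    defined for large m only. *)
Definition tracks_trace (e : Defs.idempotent A) (t : nat -> nat) :=
  exists2 q, @tracks e q & forall m, \sum_i tau m (q m i i) = (t m)%:R.

Lemma tracks_trace_exists e : exists t, tracks_trace e t.
Proof.
have [q tq] := tracks_exists e.
have [t qt] := choice (fun m => tau_idem (tq.1 m)).
by exists t, q.
Qed.

Lemma tracks_trace_sum e f s t : tracks_trace e s -> tracks_trace f t ->
  tracks_trace (idem_sum e f) (fun m => s m + t m)%N.
Proof.
move=> [q [qq qe] qs] [r [rr rf] rt].
exists (fun m => block_mx (q m) 0 0 (r m)); first split=> [m|e' e0].
- by rewrite mulmx_block !mul0mx !mulmx0 !addr0 !add0r qq rr.
- have e2 : 0 < e' / 2 by rewrite divr_gt0.
  near=> m; rewrite /phi_mx /= map_block_mx !raddf0 opp_block_mx add_block_mx !subr0.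
  rewrite mxnrm_block_diag// [ltRHS]splitr ltrD//; near: m; [exact: qe|exact: rf].
- move=> m; rewrite natrD -qs -rt big_split_ord/=; congr (_ + _).
    by apply: eq_bigr => i _; rewrite block_mxEul.
  by apply: eq_bigr => i _; rewrite block_mxEdr.
Unshelve. all: by end_near. Qed.

Lemma tracks_trace_unique e f s t : tracks_trace e s -> tracks_trace f t ->
  idem_class e = idem_class f -> \forall m \near \oo, s m = t m.
Proof.
move=> [q tq qs] [r tr rt] /(tracks_equivalent tq tr); apply: filterS => m [X [Y [XY YX]]].
apply/eqP; rewrite -(eqr_nat K) -qs -rt -XY -YX; apply/eqP.
under eq_bigr do rewrite mxE raddf_sum.
rewrite exchange_big; apply: eq_bigr => j _; rewrite mxE raddf_sum.
by apply: eq_bigr => i _; rewrite tauC.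
Qed.

Fixpoint idem_muln n (e : Defs.idempotent A) :=
  if n is k.+1 then idem_sum e (idem_muln k e) else idem0 A.

Lemma idem_class_muln n e : idem_class (idem_muln n e) = idem_class e *+ n.
Proof. by elim: n => [//|n IHn]; rewrite mulrS -IHn idem_class_sum. Qed.

Lemma tracks_trace_muln n e t : tracks_trace e t ->
  tracks_trace (idem_muln n e) (fun m => n * t m)%N.
Proof.
move=> et; elim: n => [|n IHn].
  exists (fun m => 0); first split=> [m|e' e0]; first by rewrite mul0mx.
    by near=> m; rewrite /mxnrm big_ord0.
  by move=> m; rewrite big_ord0 mul0n.
have := tracks_trace_sum et IHn.
by congr (tracks_trace _ _); apply/funext => m; rewrite mulSn.
Unshelve. all: by end_near. Qed.

Lemma tracks_trace_unit : tracks_trace (Idempotent (idem1_subproof A)) N.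
Proof.
exists (fun m => 1%:M); first split=> [m|e' e0]; first by rewrite mul1mx.
  near=> m; rewrite (_ : _ - _ = 0) ?mxnrm0//.
  by apply/matrixP => i j; rewrite !mxE raddfMn phi1 subrr.
by move=> m; rewrite big_ord1 mxE tau1.
Unshelve. all: by end_near. Qed.

(** Writing x = [e] - [f], the equation [1] = n x means that 1 + n f + g and
    n e + g are equivalent for some idempotent g; taking traces, N m + n t(f) and
    n t(e) agree for large m. *)
Theorem K0_unit_divisor (x : K0 A) n : K0_unit A = x *+ n ->
  \forall m \near \oo, (n %| N m)%N.
Proof.
elim/groth_classW: x => -[v w]; rewrite groth_mulrn => /eqP/groth_classP[] /=.
elim/idem_classW: v => e; elim/idem_classW: w => f; elim/idem_classW => g.
rewrite -!idem_class_muln addr0 (idem_class_sum _ (idem_muln n f)) !idem_class_sum.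
have [s es] := tracks_trace_exists e; have [t ft] := tracks_trace_exists f.
have [u gu] := tracks_trace_exists g.
move=> efg; have := (tracks_trace_unique
  (tracks_trace_sum (tracks_trace_sum tracks_trace_unit (tracks_trace_muln n ft)) gu)
  (tracks_trace_sum (tracks_trace_muln n es) gu) efg).
apply: filterS => m /= /addIn h.
by have := dvdn_mulr (s m) (dvdnn n); rewrite -h dvdn_addl ?dvdn_mulr.
Qed.

End Asymptotic.


(** * Operators on a finite l^p space *)

(** In a full rank factorization Q = C B the relation Q Q = Q forces B C = 1, so
    the trace of Q is that of an identity matrix of size the rank of Q. *)
Lemma idempotent_mxtrace (F : fieldType) n (Q : 'M[F]_n) : Q *m Q = Q ->
  exists r : nat, \tr Q = r%:R.
Proof.
move=> QQ; exists (\rank Q).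
have cancel r (C : 'M[F]_(n, r)) (B : 'M[F]_(r, n)) : row_full C -> row_free B ->
    C *m B *m (C *m B) = C *m B -> B *m C = 1%:M.
  move=> /row_fullP[C' C'C] /row_freeP[B' BB'] h.
  have /= := congr1 (fun M => C' *m M *m B') h.
  by rewrite !mulmxA C'C !mul1mx -!mulmxA BB' mulmx1.
have RC : row_base Q *m col_base Q = 1%:M.
  by apply: cancel; rewrite ?row_base_free ?col_base_full// mulmx_base.
by rewrite -{1}(mulmx_base Q) mxtrace_mulC RC mxtrace1.
Qed.

Section RealComplete.
Context {R : realType}.

Lemma real_geometric_cvg (u : nat -> R) c :
  (forall n, `|u n.+1 - u n| <= c * 2^-1 ^+ n) -> cvgn u.
Proof.
move=> uc.
have -> : u = (fun n => u 0%N + series (fun k => u k.+1 - u k) n).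
  by apply/funext => n; rewrite /series /= telescope_sumr// addrC subrK.
apply: is_cvgD; first exact: is_cvg_cst.
apply: normed_cvg; apply: series_le_cvg (is_cvg_geometric_series (a := c) (z := 2^-1) _) => //.
- by move=> n; exact: normr_ge0.
- by move=> n; exact: le_trans (normr_ge0 _) (uc n).
- by rewrite ger0_norm ?invr_ge0// invf_lt1// ltr1n.
Qed.

Lemma normc_ReIm (z : R[i]) : normc z <= `|complex.Re z| + `|complex.Im z|.
Proof.
case: z => a b /=; rewrite -[leRHS]ger0_norm ?addr_ge0// -sqrtr_sqr ler_wsqrtr//.
by rewrite sqrrD !real_normK ?num_real// lerD2r lerDl mulrn_wge0// mulr_ge0.
Qed.

Lemma Re_le_normc (z : R[i]) : `|complex.Re z| <= normc z.
Proof. by case: z => a b /=; rewrite -sqrtr_sqr ler_wsqrtr// lerDl sqr_ge0. Qed.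

Lemma Im_le_normc (z : R[i]) : `|complex.Im z| <= normc z.
Proof. by case: z => a b /=; rewrite -sqrtr_sqr ler_wsqrtr// lerDr sqr_ge0. Qed.

Lemma complex_geometric_cvg (u : nat -> R[i]) c :
  (forall n, normc (u n.+1 - u n) <= c * 2^-1 ^+ n) ->
  exists l, forall e, 0 < e -> \forall n \near \oo, normc (l - u n) < e.
Proof.
move=> uc.
have ReD n : complex.Re (u n.+1 - u n) = complex.Re (u n.+1) - complex.Re (u n).
  by case: (u n.+1) (u n) => [a b] [a' b'].
have ImD n : complex.Im (u n.+1 - u n) = complex.Im (u n.+1) - complex.Im (u n).
  by case: (u n.+1) (u n) => [a b] [a' b'].
have /cvg_ex[/= a ua] : cvgn (fun n => complex.Re (u n)).
  by apply: (@real_geometric_cvg _ c) => n; rewrite -ReD (le_trans (Re_le_normc _)).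
have /cvg_ex[/= b ub] : cvgn (fun n => complex.Im (u n)).
  by apply: (@real_geometric_cvg _ c) => n; rewrite -ImD (le_trans (Im_le_normc _)).
exists (a +i* b)%C => e e0.
have e2 : 0 < e / 2 by rewrite divr_gt0.
near=> n; apply: le_lt_trans (normc_ReIm _) _.
rewrite [ltRHS]splitr.
have -> : complex.Re ((a +i* b)%C - u n) = a - complex.Re (u n) by case: (u n).
have -> : complex.Im ((a +i* b)%C - u n) = b - complex.Im (u n) by case: (u n).
rewrite ltrD//; near: n.
  by have /cvgrPdist_lt := ua; apply.
by have /cvgrPdist_lt := ub; apply.
Unshelve. all: by end_near. Qed.
End RealComplete.

Section OpNorm.
Context {R : realType} (p : exponent R).

Lemma opnorm_ring_norm (X : choiceType) : ring_norm (@opnorm R p X).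
Proof.
have N1 (T : bop p X) : opnorm (- T) <= opnorm T.
  by rewrite -scaleN1r; apply: le_trans (opnormZ_le _ _) _; rewrite normcN normc1 mul1r.
split.
- exact: opnorm0.
- move=> T T0; apply: bop_ext => f; apply: lpnorm0_eq0; apply/le_anti.
  by rewrite lpnorm_ge0 andbT (le_trans (lpnorm_opnorm T f))// T0 mul0r.
- move=> T; have := N1 (- T); rewrite opprK => TN.
  by apply/le_anti/andP; split; [exact: N1|exact: TN].
- exact: opnormD.
- exact: opnormM.
Qed.

Lemma lpnorm_delta (X : choiceType) (y : X) : lpnorm (delta p y) <= 1.
Proof.
apply: lpnorm_le => //; rewrite powR1.
rewrite (_ : lp_pow p _ = 1%E)// -[RHS](@esum_set1 R X y (fun=> 1%E))//.
rewrite [RHS]esum_mkcond; apply: eq_esum => x _ /=.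
have [->|xy] := eqVneq x y; first by rewrite mem_set//= expr1n expr0n addr0 sqrtr1 powR1.
rewrite memNset//=; last by apply/eqP.
by rewrite expr0n addr0 sqrtr0 powR0 ?exponent_neq0.
Qed.

Lemma normc_entry_le (X : choiceType) (T : bop p X) x y : normc (entry T x y) <= opnorm T.
Proof.
apply: le_trans (normc_le_lpnorm _ _) _; apply: le_trans (lpnorm_opnorm _ _) _.
by rewrite ler_piMr ?opnorm_ge0 ?lpnorm_delta.
Qed.

Variable N : nat.
Local Notation I := 'I_N.

Lemma lp_delta_sum (c : I -> R[i]) x : (\sum_y c y *: delta p y) x = c x.
Proof.
rewrite lp_sumE; transitivity (\sum_y c y * (x == y)%:R).
  by apply: eq_bigr => y _; exact: lpZE.
rewrite (bigD1 x)//= eqxx mulr1 big1 ?addr0// => y yx.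
by rewrite eq_sym (negbTE yx) mulr0.
Qed.

Lemma lp_finite_sum (f : lp p I) : f = \sum_y f y *: delta p y.
Proof. by apply: lp_ext => x; rewrite lp_delta_sum. Qed.

Lemma bop_finiteE (T : bop p I) f x : T f x = \sum_y entry T x y * f y.
Proof.
rewrite {1}(lp_finite_sum f) linear_sum lp_sumE; apply: eq_bigr => y _.
by rewrite linearZ lpZE mulrC.
Qed.

Lemma lpnorm_finite_le (f : lp p I) : lpnorm f <= \sum_x normc (f x).
Proof.
rewrite {1}(lp_finite_sum f); elim/big_rec2 : _ => [|i a g _ ag]; first by rewrite lpnorm0.
apply: le_trans (lpnormD _ _) _; rewrite lerD// lpnormZ.
by rewrite ler_piMr ?normc_ge0 ?lpnorm_delta.
Qed.

Lemma normc_sum (J : Type) (r : seq J) (F : J -> R[i]) :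
  normc (\sum_(i <- r) F i) <= \sum_(i <- r) normc (F i).
Proof.
elim/big_rec2 : _ => [|i x y _ xy]; first by rewrite normc0.
by apply: le_trans (le_normcD _ _) _; rewrite lerD2l.
Qed.

Lemma opnorm_finite_le (T : bop p I) :
  opnorm T <= \sum_x \sum_y normc (entry T x y).
Proof.
apply: opnorm_le => [f|]; last by do 2!apply: sumr_ge0 => ? _; exact: normc_ge0.
apply: le_trans (lpnorm_finite_le _) _; rewrite mulr_suml; apply: ler_sum => x _.
rewrite bop_finiteE mulr_suml; apply: le_trans (normc_sum _ _) _.
by apply: ler_sum => y _; rewrite normcM ler_wpM2l ?normc_ge0 ?normc_le_lpnorm.
Qed.

Lemma finite_bop_exists (a : I -> I -> R[i]) :
  exists T : bop p I, forall x y, entry T x y = a x y.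
Proof.
pose F (f : lp p I) : lp p I := \sum_x (\sum_y a x y * f y) *: delta p x.
have FE f x : F f x = \sum_y a x y * f y.
  exact: (lp_delta_sum (fun x => \sum_y a x y * f y)).
have FP : F \in @bop_pred R p I.
  apply/asboolP; split=> [c f g|].
    apply: lp_ext => x; rewrite lpDE lpZE !FE mulr_sumr -big_split.
    by apply: eq_bigr => y _; rewrite lpDE lpZE mulrDr mulrCA.
  exists (\sum_x \sum_y normc (a x y)) => f.
  apply: le_trans (lpnorm_finite_le _) _; rewrite mulr_suml; apply: ler_sum => x _.
  rewrite FE mulr_suml; apply: le_trans (normc_sum _ _) _.
  by apply: ler_sum => y _; rewrite normcM ler_wpM2l ?normc_ge0 ?normc_le_lpnorm.
exists (Bop FP) => x y; rewrite /entry [LHS]FE (bigD1 y)//= eqxx mulr1 big1 ?addr0// => z zy.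
by rewrite (negbTE zy) mulr0.
Qed.

Lemma entryB (X : choiceType) (T U : bop p X) x y : entry (T - U) x y = entry T x y - entry U x y.
Proof. by []. Qed.

Lemma finite_bop_complete : ring_norm_complete (@opnorm R p I).
Proof.
move=> u c uc.
have H x y : exists l, forall e, 0 < e -> \forall n \near \oo, normc (l - entry (u n) x y) < e.
  apply: (@complex_geometric_cvg _ _ c) => n; rewrite -entryB.
  exact: le_trans (normc_entry_le _ _ _) (uc n).
have [T TP] := finite_bop_exists (fun x y => projT1 (cid (H x y))).
exists T => e e0.
have d0 : 0 < e / (N * N + 1)%:R by rewrite divr_gt0// ltr0n addn1.
have K : \forall k \near \oo, forall xy : I * I,
    normc (entry (T - u k) xy.1 xy.2) < e / (N * N + 1)%:R.
  apply: filter_forall => -[x y] /=; apply: filterS (projT2 (cid (H x y)) _ d0) => k.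
  by rewrite entryB TP.
near=> k; apply: le_lt_trans (opnorm_finite_le _) _.
have Kk : forall xy : I * I, normc (entry (T - u k) xy.1 xy.2) < e / (N * N + 1)%:R.
  by near: k.
have := @mxnrm_lt R R[i] (@normc R) N N (\matrix_(x, y) entry (T - u k) x y) e e0.
rewrite /mxnrm; under eq_bigr do under eq_bigr do rewrite mxE.
by apply=> x y; rewrite mxE; exact: (Kk (x, y)).
Unshelve. all: by end_near. Qed.

Definition bop_mx (T : bop p I) : 'M[R[i]]_N := \matrix_(x, y) entry T x y.

Lemma bop_mxM T U : bop_mx (T * U) = bop_mx T *m bop_mx U.
Proof.
apply/matrixP => x y; rewrite !mxE /entry bopME bop_finiteE.
by apply: eq_bigr => z _; rewrite !mxE.
Qed.

Lemma bop_mx_linear : linear bop_mx.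
Proof. by move=> c T U; apply/matrixP => x y; rewrite !mxE. Qed.

HB.instance Definition _ := GRing.isLinear.Build _ _ _ _ bop_mx bop_mx_linear.

Definition bop_trace (T : bop p I) : R[i] := \tr (bop_mx T).

Lemma bop_trace_linear : linear_for *%R bop_trace.
Proof. by move=> c T U; rewrite /bop_trace linearP linearP. Qed.

HB.instance Definition _ := GRing.isLinear.Build _ _ _ _ bop_trace bop_trace_linear.

Lemma bop_traceC T U : bop_trace (T * U) = bop_trace (U * T).
Proof. by rewrite /bop_trace !bop_mxM mxtrace_mulC. Qed.

Lemma bop_trace1 : bop_trace 1 = N%:R.
Proof.
rewrite /bop_trace (_ : bop_mx 1 = 1%:M) ?mxtrace1//.
by apply/matrixP => x y; rewrite !mxE.
Qed.

(** A matrix of operators on a finite l^p space is flattened into one complex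
    matrix. *)
Lemma bop_trace_idem k (Q : 'M[bop p I]_k) : Q *m Q = Q ->
  exists n : nat, \sum_i bop_trace (Q i i) = n%:R.
Proof.
move=> QQ; pose B := \mxblock_(i < k, j < k) bop_mx (Q i j).
have [|n Bn] := @idempotent_mxtrace _ _ B.
  rewrite /B mul_mxblock; apply: eq_mxblock => i j.
  rewrite -{3}QQ mxE linear_sum; apply: eq_bigr => l _.
  exact/esym/bop_mxM.
by exists n; rewrite -Bn mxtrace_mxblock.
Qed.

End OpNorm.


(** * Towers of blocks *)

Section Towers.
Context {R : realType}.

(** Points are ranked by integers so that, for each k, the blocks of size_ k
    consecutive ranks form a uniformly bounded partition, and these partitions
    eventually join any two points at a given distance.  The ranks in use are
    those below some size_ k: all of nat, or an initial segment when X is finite. *)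
Record tower (X : metricType R) (size_ : nat -> nat) (rank : X -> nat)
    (elt : nat -> X) : Prop := Tower {
  tower_gt0 : forall k, (0 < size_ k)%N;
  tower_dvdS : forall k, (size_ k %| size_ k.+1)%N;
  tower_rankK : cancel rank elt;
  tower_rank_lt : forall x, exists k, (rank x < size_ k)%N;
  tower_eltK : forall k i, (i < size_ k)%N -> rank (elt i) = i;
  tower_bounded : forall k, exists r, forall x y,
    (rank x %/ size_ k = rank y %/ size_ k)%N -> mdist x y <= r;
  tower_coarse : forall r, exists k, forall x y,
    mdist x y <= r -> (rank x %/ size_ k = rank y %/ size_ k)%N }.

Lemma divn_block_dvd (a b i j : nat) : (0 < a)%N -> (a %| b)%N ->
  (i %/ a = j %/ a)%N -> (i %/ b = j %/ b)%N.
Proof. by move=> a0 /dvdnP[c ->] ij; rewrite mulnC !divnMA ij. Qed.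

Lemma tower_dvd X n_ rank elt : @tower X n_ rank elt ->
  forall k l, (k <= l)%N -> (n_ k %| n_ l)%N.
Proof.
move=> tw k l /subnK <-; elim: (l - k)%N => [//|i IHi].
by rewrite addSn (dvdn_trans IHi) ?(tower_dvdS tw).
Qed.

(** Matching equal ranks sends a block of size n_ k into a block of any size that
    n_ k divides. *)
Lemma tower_coarse_map X Y n_ rX eX m_ rY eY :
  @tower X n_ rX eX -> @tower Y m_ rY eY ->
  (forall k, exists l, (n_ k %| m_ l)%N) -> uniformly_expansive (eY \o rX).
Proof.
move=> tX tY nm r r0; have [k kP] := tower_coarse tX r.
have [l kl] := nm k; have [s sP] := tower_bounded tY l.
exists (`|s| + 1) => [|x y /kP xy]; first by rewrite ltr_wpDl.
have rankE z : rY ((eY \o rX) z) = rX z.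
  have [i zi] := tower_rank_lt tX z; have [j ij] := nm i.
  by apply: (tower_eltK tY (leq_trans zi (dvdn_leq (tower_gt0 tY j) ij))).
apply: le_trans (sP _ _ _) _; last by rewrite (le_trans (ler_norm s))// lerDl.
by rewrite !rankE; exact: divn_block_dvd (tower_gt0 tX k) kl xy.
Qed.

Lemma tower_coarse_equivalent X Y n_ rX eX m_ rY eY :
  @tower X n_ rX eX -> @tower Y m_ rY eY ->
  (forall k, exists l, (n_ k %| m_ l)%N) -> (forall k, exists l, (m_ k %| n_ l)%N) ->
  bijectively_coarsely_equivalent X Y.
Proof.
move=> tX tY nm mn.
have fK : cancel (eY \o rX) (eX \o rY).
  move=> x /=; have [i zi] := tower_rank_lt tX x; have [j ij] := nm i.
  by rewrite (tower_eltK tY (leq_trans zi (dvdn_leq (tower_gt0 tY j) ij))) (tower_rankK tX).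
have gK : cancel (eX \o rY) (eY \o rX).
  move=> x /=; have [i zi] := tower_rank_lt tY x; have [j ij] := mn i.
  by rewrite (tower_eltK tX (leq_trans zi (dvdn_leq (tower_gt0 tX j) ij))) (tower_rankK tY).
exists (eY \o rX); last by exists (eX \o rY).
split; first exact: tower_coarse_map tX tY nm.
exists (eX \o rY); split; first exact: tower_coarse_map tY tX mn.
  by exists 0 => y; rewrite /= -/((eX \o rY) y) [eY _]gK mdistxx.
by exists 0 => x; rewrite /= -/((eY \o rX) x) [eX _]fK mdistxx.
Qed.

(** ** Divisors of block sizes divide the unit class *)

Section Shifts.
Variables (p : exponent R) (X : metricType R).

Lemma finite_propagation_roe (T : bop p X) : finite_propagation T -> T \in @roe_pred R p X.
Proof. by move=> Tf; apply/asboolP => e e0; exists T; rewrite // subrr opnorm0. Qed.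

Definition pull_bop (s : partial_inj X X) : bop p X := sandwich s (total_inj (@inj_id X)) 1.

Lemma pull_bopE s f x : pull_bop s f x = oapp f 0 (s x).
Proof. by rewrite /pull_bop sandwichE lpullE; case: (s x). Qed.

Lemma pull_bop_roe (s : partial_inj X X) (r : R) :
  (forall x y, s x = Some y -> mdist x y <= r) -> pull_bop s \in @roe_pred R p X.
Proof.
move=> sr; apply: finite_propagation_roe; apply/finite_propagationP.
exists `|r| => // x y; rewrite /entry pull_bopE; case E : (s x) => [z|]; last by rewrite eqxx.
rewrite /=; have [zy _|_] := eqVneq z y; last by rewrite eqxx.
by rewrite (le_trans (sr _ _ _))// ?ler_norm// E zy.
Qed.

(** sh j x is the point of colour j that corresponds to x, at bounded distance
    from x.  The operators U i j, which read a function at colour j and write it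
    at colour i, behave as matrix units. *)
Lemma uniform_colouring_divides (c : X -> nat) (sh : nat -> X -> X) d (r : R) :
  (forall x, c x < d)%N -> (forall j x, c (sh j x) = j %% d)%N ->
  (forall i j x, sh i (sh j x) = sh i x) -> (forall x, sh (c x) x = x) ->
  (forall j x, mdist x (sh j x) <= r) -> (0 < d)%N ->
  exists x : K0 (roe p X), K0_unit (roe p X) = x *+ d.
Proof.
move=> cd csh shsh shc shr d0.
pose U0 i j x := if c x == i then Some (sh j x) else None.
have U0P i j x x' y : U0 i j x = Some y -> U0 i j x' = Some y -> x = x'.
  rewrite /U0; case: eqP => // <- [<-]; case: eqP => // cx' [/(congr1 (sh (c x)))].
  by rewrite !shsh shc -cx' shc.
pose U1 i j : partial_inj X X := PartialInj (U0P i j).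
have U1r i j x y : U1 i j x = Some y -> mdist x y <= r.
  by rewrite /= /U0; case: eqP => // _ [<-].
pose U i j : roe p X := RoeOp (pull_bop_roe (U1r i j)).
have UE i j (f : lp p X) x : (U i j : bop p X) f x = if c x == i then f (sh j x) else 0.
  by rewrite -[LHS]/(pull_bop (U1 i j) f x) pull_bopE /= /U0; case: ifP.
have roe_ext (S T : roe p X) : (forall (f : lp p X) x, (S : bop p X) f x = (T : bop p X) f x) -> S = T.
  by move=> h; apply/val_inj/bop_ext => f; apply/lp_ext/h.
have roeM (S T : roe p X) (f : lp p X) x :
  ((S * T : roe p X) : bop p X) f x = (S : bop p X) ((T : bop p X) f) x by [].
have UM i j l : (j < d)%N -> U i j * U j l = U i l.
  move=> jd; apply: roe_ext => f x; rewrite roeM !UE csh modn_small// eqxx shsh.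
  by [].
have UM0 i j k l : (j < d)%N -> j != k -> U i j * U k l = 0.
  move=> jd jk; apply: roe_ext => f x; rewrite roeM !UE csh modn_small// (negbTE jk).
  by case: ifP.
apply: (@K0_unit_divisible _ d (fun i => U i i) d0) => [i id|i j id jd ij|i id|].
- exact: UM.
- exact: UM0.
- by exists (U i 0%N), (U 0%N i); split; apply: UM.
apply: roe_ext => f x.
have evD (S T : roe p X) : ((S + T : roe p X) : bop p X) f x =
    (S : bop p X) f x + (T : bop p X) f x by [].
have sumE (s : seq 'I_d) : ((\sum_(i <- s) U i i : roe p X) : bop p X) f x =
    \sum_(i <- s) (if c x == i then f x else 0).
  elim: s => [|i s IHs]; first by rewrite !big_nil.
  rewrite [in RHS]big_cons -IHs big_cons evD; congr (_ + _).
  by rewrite UE; case: eqP => // <-; rewrite shc.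
rewrite sumE (bigD1 (Ordinal (cd x)))//= eqxx big1 ?addr0// => i.
by rewrite -val_eqE/= eq_sym => /negbTE ->.
Qed.

End Shifts.

(** Each block of n_ k = d q ranks is cut into d runs of length q; the colour of a
    point is the number of its run, and points correspond if they have the same
    place in their runs. *)
Lemma tower_divides (p : exponent R) X n_ rank elt d k : @tower X n_ rank elt ->
  (d %| n_ k)%N -> exists x : K0 (roe p X), K0_unit (roe p X) = x *+ d.
Proof.
move=> tw /dvdnP[q nE].
have n0 := tower_gt0 tw k.
have [q0 d0] : (0 < q /\ 0 < d)%N by apply/andP; rewrite -muln_gt0 -nE.
(* the index is reduced modulo d only to make the operators total in j *)
pose idx j i := (i %/ n_ k * n_ k + (j %% d * q + i %% q))%N.
have off j i : (j %% d * q + i %% q < n_ k)%N.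
  rewrite nE; apply: (@leq_trans (j %% d * q + q)%N); first by rewrite ltn_add2l ltn_mod.
  by rewrite -mulSnr mulnC leq_mul2l ltn_mod d0 orbT.
have idx_block j i : (idx j i %/ n_ k = i %/ n_ k)%N.
  by rewrite /idx divnMDl// (divn_small (off _ _)) addn0.
have rank_idx j x : rank (elt (idx j (rank x))) = idx j (rank x).
  have [l xl] := tower_rank_lt tw x.
  pose m := maxn k l; apply: (tower_eltK tw (k := m)).
  have /dvdnP[a ma] := tower_dvd tw (leq_maxl k l : (k <= m)%N).
  have xm : (rank x < n_ m)%N.
    apply: leq_trans xl _; apply: dvdn_leq; first exact: (tower_gt0 tw).
    by apply: (tower_dvd tw); exact: (leq_maxr k l).
  by rewrite ma -ltn_divLR// idx_block ltn_divLR// -ma.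
have idxE j i : idx j i = ((i %/ n_ k * d + j %% d) * q + i %% q)%N.
  by rewrite /idx {2}nE mulnDl -mulnA [(d * q)%N]mulnC addnA.
have idx_q j i : (idx j i %/ q = i %/ n_ k * d + j %% d)%N.
  by rewrite idxE divnMDl// [(i %% q %/ q)%N]divn_small ?addn0 ?ltn_mod.
have idx_mod j i : (idx j i %% q = i %% q)%N by rewrite idxE modnMDl modn_mod.
pose c x := ((rank x %/ q) %% d)%N; pose sh j x := elt (idx j (rank x)).
have [r rP] := tower_bounded tw k.
apply: (@uniform_colouring_divides p X c sh d r) => //.
- by move=> x; rewrite /c ltn_mod.
- by move=> j x; rewrite /c /sh rank_idx idx_q modnMDl modn_mod.
- by move=> i j x; rewrite /sh rank_idx {1}/idx idx_block idx_mod.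
- move=> x; rewrite /sh /c idxE modn_mod -[RHS](tower_rankK tw); congr elt.
  by rewrite nE divnMA -!divn_eq.
- by move=> j x; apply: rP; rewrite /sh rank_idx idx_block.
Qed.

(** ** Divisors of the unit class divide block sizes *)

Section Compression.
Variables (p : exponent R) (X : metricType R) (n_ : nat -> nat).
Variables (rank : X -> nat) (elt : nat -> X).
Hypothesis tw : tower n_ rank elt.

Lemma block_incl_inj m : injective (fun i : 'I_(n_ m) => elt i).
Proof.
move=> i j /(congr1 rank); rewrite !(tower_eltK tw (ltn_ord _)); exact: val_inj.
Qed.

Lemma block_proj_subproof m x x' (i : 'I_(n_ m)) :
  insub (rank x) = Some i -> insub (rank x') = Some i -> x = x'.
Proof.
case: insubP => // u _ ux [ui]; case: insubP => // u' _ u'x' [u'i].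
by apply: (can_inj (tower_rankK tw)); rewrite -ux -u'x' ui u'i.
Qed.

Definition block_incl m : partial_inj 'I_(n_ m) X := total_inj (@block_incl_inj m).
Definition block_proj m : partial_inj X 'I_(n_ m) := PartialInj (@block_proj_subproof m).

Definition compress m (T : roe p X) : bop p 'I_(n_ m) :=
  sandwich (block_incl m) (block_proj m) (roe_val T).

Lemma compress_additive m : {morph compress m : S T / S - T}.
Proof. by move=> S T; rewrite /compress -linearB. Qed.

HB.instance Definition _ m :=
  GRing.isAdditive.Build _ _ (compress m) (compress_additive m).

Lemma block_inclK m (f : lp p 'I_(n_ m)) : lpull (block_incl m) (lpull (block_proj m) f) = f.
Proof.
by apply: lp_ext => i; rewrite !lpullE /= (tower_eltK tw (ltn_ord i)) valK.
Qed.

Lemma block_projK m (g : lp p X) : (forall x, (n_ m <= rank x)%N -> g x = 0) ->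
  lpull (block_proj m) (lpull (block_incl m) g) = g.
Proof.
move=> g0; apply: lp_ext => x; rewrite lpullE /=.
case: insubP => [i _ ix|]; last by rewrite -leqNgt => /g0 ->.
by rewrite /= ix (tower_rankK tw).
Qed.

Lemma compress1 m : compress m 1 = 1.
Proof. by apply: bop_ext => f; rewrite /compress sandwichE /= block_inclK. Qed.

(** Once the blocks of size n_ m absorb the propagation of T, the operator T maps
    functions supported on the first block to such functions, and the projection
    between S and T in the right-hand side becomes superfluous. *)
Lemma sandwich_finite_propagationM (S T : bop p X) : finite_propagation T ->
  \forall m \near \oo, sandwich (block_incl m) (block_proj m) (S * T) =
    sandwich (block_incl m) (block_proj m) S * sandwich (block_incl m) (block_proj m) T.
Proof.
move=> /finite_propagationP[r r0 Tr]; have [k kP] := tower_coarse tw r.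
exists k => // m /= km; apply: bop_ext => f; rewrite bopME !sandwichE bopME.
rewrite block_projK// => x mx; apply: entry0 => y.
rewrite lpullE /=; case: insubP => [i ym iy|]; last by rewrite eqxx.
move=> _; apply: contrapT => /eqP/Tr/kP xy.
have := divn_block_dvd (tower_gt0 tw k) (tower_dvd tw km) xy.
rewrite (divn_small ym) => /eqP; rewrite -leqn0 leqNgt divn_gt0 ?mx//.
exact: tower_gt0 tw m.
Qed.

(** For T' of finite propagation near T, the error for T is that for T - T', of
    norm at most 2 |S| |T - T'|. *)
Lemma compressM (S T : roe p X) e : 0 < e ->
  \forall m \near \oo, opnorm (compress m (S * T) - compress m S * compress m T) < e.
Proof.
move=> e0; have S0 : 0 < 2 * (opnorm S + 1).
  by rewrite mulr_gt0// ltr_wpDl ?opnorm_ge0.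
have /asboolP/(_ _ (divr_gt0 e0 S0))[T' T'f TT'] := roe_valP T.
have := sandwich_finite_propagationM S T'f; apply: filterS => m h.
set J := sandwich _ _ in h.
have -> : compress m (S * T) - compress m S * compress m T =
    J (roe_val S * (roe_val T - T')) - J (roe_val S) * J (roe_val T - T').
  have JB U V : J (U - V) = J U - J V by rewrite /J linearB.
  by rewrite mulrBr !JB h mulrBr opprB addrA subrK.
have nP := opnorm_ring_norm p.
apply: le_lt_trans (rnB (nP _) _ _) _.
apply: le_lt_trans (_ : 2 * (opnorm S + 1) * opnorm (roe_val T - T') < _); last first.
  by rewrite mulrC -ltr_pdivlMr.
rewrite -mulrA mulr_natl mulr2n; apply: lerD.
  apply: le_trans (opnorm_sandwich _ _ _) _; apply: le_trans (opnormM _ _) _.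
  by rewrite ler_wpM2r ?opnorm_ge0// lerDl.
apply: le_trans (opnormM _ _) _; apply: ler_pM; rewrite ?opnorm_ge0 ?opnorm_sandwich//.
by apply: le_trans (opnorm_sandwich _ _ _) _; rewrite lerDl.
Qed.

Lemma tower_divisor (x : K0 (roe p X)) d : K0_unit (roe p X) = x *+ d ->
  exists k, (d %| n_ k)%N.
Proof.
move=> xd; have /= h := @K0_unit_divisor R R[i] (roe p X) (fun T => opnorm T)
  (fun m => bop p 'I_(n_ m)) (fun m => @opnorm R p 'I_(n_ m)) compress
  (fun m => @bop_trace R p (n_ m)) n_
  (fun m => opnorm_ring_norm p _) (fun m => @finite_bop_complete R p (n_ m)).
have [k _ kP] := h (fun m a => opnorm_sandwich _ _ _) compress1 compressM
  (fun m a b => bop_traceC a b) (fun m => bop_trace1 p (n_ m))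
  (fun m k Q => @bop_trace_idem R p (n_ m) k Q) x d xd.
by exists k; apply: kP => /=.
Qed.

End Compression.
End Towers.


(** * Locally finite groups as towers *)

Section GroupTower.
Variable G : groupType.
Implicit Types (H K : set G) (s : seq G).

Definition left_difference_closed H := H 1%g /\ forall x y, H x -> H y -> H (x^-1 * y)%g.

Lemma ldcM H x y : left_difference_closed H -> H x -> H y -> H (x * y)%g.
Proof.
move=> [H1 HM] Hx Hy; rewrite -[x]invgK; apply: (HM) => //.
by rewrite -[(x^-1)%g]mulg1; exact: HM.
Qed.

Lemma ldcV H x : left_difference_closed H -> H x -> H (x^-1)%g.
Proof. by move=> [H1 HM] Hx; rewrite -[(x^-1)%g]mulg1; exact: HM. Qed.

Lemma ldc_cancel H x y : left_difference_closed H -> H x -> H (x^-1 * y)%g -> H y.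
Proof. by move=> Hs Hx /(ldcM Hs Hx); rewrite mulgA mulgV mul1g. Qed.

(** A listing s' of a group consists of translates t s of a listing s of the
    subgroup H: positions in the same block of length |s| are exactly those in
    the same left coset of H, and left quotients inside a block are those of s. *)
Definition coset_blocks H s s' := forall i j, (i < size s')%N -> (j < size s')%N ->
  (H ((nth 1 s' i)^-1 * nth 1 s' j)%g -> (i %/ size s = j %/ size s)%N) /\
  ((i %/ size s = j %/ size s)%N -> ((nth 1 s' i)^-1 * nth 1 s' j)%g =
     ((nth 1 s (i %% size s))^-1 * nth 1 s (j %% size s))%g).

Lemma nth_blocks (T s : seq G) i : (i < size T * size s)%N ->
  nth 1%g [seq (t * y)%g | t <- T, y <- s] i =
  (nth 1 T (i %/ size s) * nth 1 s (i %% size s))%g.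
Proof.
elim: T i => [//|t T IHT] i; rewrite allpairs_cons [size (t :: T)]/= mulSn nth_cat size_map.
have [s0|s0] := posnP (size s); first by rewrite s0 muln0.
case: (ltnP i (size s)) => [is_ _|si].
  rewrite (nth_map 1%g)//.
  by rewrite divn_small// modn_small.
rewrite -{1}(subnKC si) ltn_add2l => /IHT ->.
by rewrite -{3 4}(subnKC si) divnDl ?dvdnn// divnn s0 add1n modnDl.
Qed.

(** K is listed as t_0 s, t_1 s, ... where the t_i represent the left cosets of H
    and t_0 = 1, so that the new listing begins with s. *)
Lemma extend_coset_listing H K s :
  left_difference_closed H -> left_difference_closed K -> H `<=` K -> finite_set K ->
  uniq s -> (forall x, x \in s <-> H x) ->
  exists s', [/\ uniq s', (forall x, x \in s' <-> K x), prefix s s',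
    (size s %| size s')%N & coset_blocks H s s'].
Proof.
move=> Hs Ks HK Kf us sP.
(* a representative that depends only on the coset of x, and is 1 on H *)
pose rho x := if `[< H x >] then 1%g else xget 1%g [set y | H (x^-1 * y)%g].
have rhoP x : H (x^-1 * rho x)%g.
  rewrite /rho; case: asboolP => [Hx|_]; first by rewrite mulg1; exact: ldcV.
  by case: xgetP => [y -> //|/(_ x)[]]; rewrite /= mulVg; case: Hs.
have rho_eq x y : H (x^-1 * y)%g -> rho x = rho y.
  move=> xy; rewrite /rho.
  have -> : `[< H x >] = `[< H y >].
    apply/asboolP/asboolP => h; first by rewrite -[y](mulVKg x); exact: ldcM.
    rewrite -[x](mulVKg y); apply: ldcM => //.
    by rewrite -[(y^-1 * x)%g]invgK invgM invgK; exact: ldcV.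
  case: asboolP => // _; congr xget; apply/seteqP; split=> z /= h.
    by have := Hs.2 _ _ xy h; rewrite invgM invgK -mulgA mulVKg.
  by have := ldcM Hs xy h; rewrite -mulgA mulVKg.
have rho1 : rho 1%g = 1%g by rewrite /rho; case: asboolP => // -[]; case: Hs.
pose L := finmap.enum_fset (fset_set K).
have LP x : x \in L <-> K x.
  have -> : (x \in L) = (x \in K) by rewrite -in_fset_set.
  by rewrite inE.
pose T := 1%g :: [seq t <- undup (map rho L) | t != 1%g].
have TP t : t \in T -> K t /\ rho t = t.
  rewrite inE mem_filter mem_undup => /orP[/eqP ->|/andP[_ /mapP[x xL ->]]].
    by split=> //; case: Ks.
  have Hr := rhoP x; split; last exact/esym/rho_eq.
  by apply: (ldc_cancel Ks _ (HK _ Hr)); exact/LP.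
have T1 x : K x -> rho x \in T.
  move=> Kx; rewrite inE; have [//|r1 /=] := eqVneq (rho x) 1%g.
  by rewrite mem_filter r1 mem_undup map_f//; exact/LP.
have uT : uniq T by rewrite /= mem_filter eqxx filter_uniq ?undup_uniq.
have TI t t' : t \in T -> t' \in T -> H (t^-1 * t')%g -> t = t'.
  by move=> /TP[_ tt] /TP[_ tt'] /rho_eq; rewrite tt tt'.
have [T' TE] : exists T', T = 1%g :: T' by exists [seq t <- undup (map rho L) | t != 1%g].
clearbody T.
have tyI t y t' y' : t \in T -> y \in s -> t' \in T -> y' \in s ->
    H ((t * y)^-1 * (t' * y'))%g -> t = t'.
  move=> tT ys t'T y's h; apply: TI => //.
  have := ldcM Hs (ldcM Hs (iffLR (sP y) ys) h) (ldcV Hs (iffLR (sP y') y's)).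
  by rewrite invgM -!mulgA mulVKg mulgV mulg1.
have s0 : (0 < size s)%N.
  by have := iffRL (sP 1%g) Hs.1; case: (s).
exists [seq (t * y)%g | t <- T, y <- s]; split.
- apply: allpairs_uniq => // -[t y] [t' y'] /allpairsP[[a b] /= [aT bs [-> ->]]].
  move=> /allpairsP[[a' b'] /= [a'T b's [-> ->]]] ab.
  have aa' : a = a' by apply: (tyI a b a' b') => //; rewrite -ab mulVg; case: Hs.
  by move: ab; rewrite aa' => /mulgI ->.
- move=> x; split=> [/allpairsP[[t y] /= [tT ys ->]]|Kx].
    by apply: ldcM => //; [case: (TP _ tT)|apply/HK/sP].
  apply/allpairsP; exists (rho x, (rho x)^-1 * x)%g => /=; split; first exact: T1.
    by apply/sP; have := ldcV Hs (rhoP x); rewrite invgM invgK.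
  by rewrite mulVKg.
- by rewrite TE allpairs_cons (eq_map mul1g) map_id prefix_prefix.
- by rewrite size_allpairs dvdn_mull.
move=> i j; rewrite size_allpairs => iT jT; rewrite !nth_blocks//.
have iq k : (k < size T * size s)%N -> nth 1%g T (k %/ size s) \in T.
  by move=> kT; rewrite mem_nth// ltn_divLR.
have ir k : nth 1%g s (k %% size s) \in s by rewrite mem_nth// ltn_mod.
split=> [/tyI|ij].
  move=> /(_ (iq _ iT) (ir _) (iq _ jT) (ir _)) /eqP.
  by rewrite nth_uniq// ?ltn_divLR// => /eqP.
by rewrite ij invgM -mulgA mulKg.
Qed.

End GroupTower.


Section GroupChain.
Variables (G : groupType) (F : nat -> set G).
Hypothesis F_closed : forall k, left_difference_closed (F k).
Hypothesis F_sub : forall k, F k `<=` F k.+1.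
Hypothesis F_finite : forall k, finite_set (F k).
Hypothesis F_all : forall x, exists k, F k x.

Lemma coset_listings_exist : exists s_ : nat -> seq G,
  [/\ forall k, uniq (s_ k), forall k x, x \in s_ k <-> F k x,
      forall k, prefix (s_ k) (s_ k.+1), forall k, (size (s_ k) %| size (s_ k.+1))%N &
      forall k, coset_blocks (F k) (s_ k) (s_ k.+1)].
Proof.
pose good k s := uniq s /\ forall x, x \in s <-> F k x.
pose next k s s' := [/\ prefix s s', (size s %| size s')%N & coset_blocks (F k) s s'].
have step k (s : {s | good k s}) : exists s' : {s' | good k.+1 s'}, next k (sval s) (sval s').
  have [us sF] := svalP s.
  have [s' [us' s'F ? ? ?]] :=
    extend_coset_listing (F_closed k) (F_closed k.+1) (@F_sub k) (F_finite k.+1) us sF.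
  by exists (exist _ s' (conj us' s'F)).
have start : good 0%N (finmap.enum_fset (fset_set (F 0%N))).
  split=> [|x]; first exact: finmap.fset_uniq.
  by rewrite (_ : (x \in _) = (x \in F 0%N)) ?inE// -in_fset_set.
pose t_ := fix t_ k : {s | good k s} :=
  if k is k'.+1 then projT1 (cid (step k' (t_ k'))) else exist _ _ start.
have tP k : next k (sval (t_ k)) (sval (t_ k.+1)) by exact: projT2 (cid (step k (t_ k))).
exists (fun k => sval (t_ k)); split=> k; try by case: (svalP (t_ k)).
- by case: (tP k).
- by case: (tP k).
- by case: (tP k).
Qed.

(** The listings of the F k are prefixes of one another, so positions in them do
    not depend on k.  The blocks at level k are the cosets of F k in all later
    listings, by induction along the chain: an element of F k lies in F m, hence
    does not leave a block of level m, and inside that block left quotients are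
    those of the preceding listing. *)
Lemma group_chain_ranking : exists size_ rank elt, [/\
  forall k, (0 < size_ k)%N, forall k, (size_ k %| size_ k.+1)%N, cancel rank elt,
  forall x : G, exists k, (rank x < size_ k)%N &
  (forall k i, (i < size_ k)%N -> rank (elt i) = i) /\
  forall k x y, F k (x^-1 * y)%g <-> (rank x %/ size_ k = rank y %/ size_ k)%N].
Proof.
have [s_ [us sF spre sdvd sblk]] := coset_listings_exist.
pose size_ k := size (s_ k).
have size_gt0 k : (0 < size_ k)%N.
  by have := iffRL (sF k 1%g) (F_closed k).1; rewrite /size_; case: (s_ k).
have mono k l : (k <= l)%N -> prefix (s_ k) (s_ l).
  move=> /subnK <-; elim: (l - k)%N => [|i IHi]; first exact: prefix_refl.
  by rewrite addSn (prefix_trans IHi).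
have nth_mono k l i : (i < size_ k)%N -> (k <= l)%N -> nth 1%g (s_ l) i = nth 1%g (s_ k) i.
  by move=> ik /mono/prefixP[s' ->]; rewrite nth_cat ik.
have index_mono k l x : x \in s_ k -> (k <= l)%N -> index x (s_ l) = index x (s_ k).
  by move=> xk /mono/prefixP[s' ->]; rewrite index_cat xk.
have mem_ex x : exists k, x \in s_ k by have [k kx] := F_all x; exists k; exact/sF.
pose rank x := index x (s_ (projT1 (cid (mem_ex x)))).
pose elt i := nth 1%g (s_ (xget 0%N [set k | (i < size_ k)%N])) i.
have rankE k x : x \in s_ k -> rank x = index x (s_ k).
  rewrite /rank; case: cid => l /= xl xk.
  by have [kl|/ltnW lk] := leqP k l; [rewrite (index_mono k)|rewrite (index_mono l k)].
have eltE k i : (i < size_ k)%N -> elt i = nth 1%g (s_ k) i.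
  move=> ik; rewrite /elt; case: xgetP => [l _ /= il|/(_ k)//].
  by have [kl|/ltnW lk] := leqP k l; [rewrite (nth_mono k)|rewrite (nth_mono l k)].
have dvd k l : (k <= l)%N -> (size_ k %| size_ l)%N.
  move=> /subnK <-; elim: (l - k)%N => [//|i IHi].
  by rewrite addSn (dvdn_trans IHi)//; exact: sdvd.
have Fmono k l : (k <= l)%N -> F k `<=` F l.
  move=> /subnK <-; elim: (l - k)%N => [//|i IHi] x /IHi.
  by rewrite addSn; exact: F_sub.
have blk k l : (k <= l)%N -> forall i j, (i < size_ l)%N -> (j < size_ l)%N ->
    F k ((nth 1 (s_ l) i)^-1 * nth 1 (s_ l) j)%g <-> (i %/ size_ k = j %/ size_ k)%N.
  move=> /subnK <-; elim: (l - k)%N => [|d IHd] i j.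
    rewrite add0n => ik jk; rewrite !divn_small//; split=> // _.
    by apply: (F_closed k).2; apply/sF; exact: mem_nth.
  rewrite addSn; set m := (d + k)%N => im jm.
  have km : (k <= m)%N by exact: leq_addl.
  have split_div a : (a %/ size_ k = a %/ size_ m * (size_ m %/ size_ k) + a %% size_ m %/ size_ k)%N.
    rewrite {1}(divn_eq a (size_ m)) -{2}(divnK (dvd k m km)) mulnA divnMDl//.
  have IH a b : F k ((nth 1 (s_ m) (a %% size_ m))^-1 * nth 1 (s_ m) (b %% size_ m))%g <->
      (a %% size_ m %/ size_ k = b %% size_ m %/ size_ k)%N.
    by apply: IHd; rewrite ltn_mod.
  have [blk1 blk2] := sblk m i j im jm.
  split=> [h|h].
    have ij : (i %/ size_ m = j %/ size_ m)%N.
      by apply: blk1; exact: Fmono km _ h.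
    by rewrite split_div ij [RHS]split_div; congr (_ + _)%N; apply/IH; rewrite -blk2.
  have ij : (i %/ size_ m = j %/ size_ m)%N := divn_block_dvd (size_gt0 k) (dvd k m km) h.
  rewrite blk2//; apply/IH; move: h; rewrite split_div ij [RHS]split_div.
  exact: addnI.
exists size_, rank, elt; split=> //.
- by move=> x; have [k xk] := mem_ex x; rewrite (rankE k)// (eltE k) ?nth_index// index_mem.
- by move=> x; have [k xk] := mem_ex x; exists k; rewrite (rankE k)// index_mem.
split=> [k i ik|k x y].
  by rewrite (eltE k)// (rankE k) ?mem_nth// index_uniq.
have [a xa] := mem_ex x; have [b yb] := mem_ex y.
pose l := maxn k (maxn a b).
have mem_mono c z : (c <= l)%N -> z \in s_ c -> z \in s_ l.
  by move=> /mono/prefixP[s' ->] zc; rewrite mem_cat zc.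
have xl : x \in s_ l by apply: mem_mono xa; rewrite /l !leq_max leqnn orbT.
have yl : y \in s_ l by apply: mem_mono yb; rewrite /l !leq_max leqnn !orbT.
rewrite !(rankE l)// -(blk k l) ?leq_maxl// ?index_mem//.
by rewrite !nth_index.
Qed.

End GroupChain.

Section MetricGroup.
Context {R : realType}.
Variable G : metricGroupType R.
Hypotheses (G_locally_finite : locally_finite G) (G_proper : proper_metric G)
  (G_left_invariant : left_invariant G).

(** Properness makes balls finite and local finiteness makes the subgroups that
    they generate finite; left invariance reduces the distance of x and y to the
    distance of 1 and the left quotient of x and y. *)
Lemma group_tower : exists size_ rank elt, @tower R G size_ rank elt.
Proof.
pose B k := fset_set [set y : G | mdist 1%g y <= k%:R].
pose F k := generated_subgroup (finmap.enum_fset (B k)).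
have BP k x : (x \in finmap.enum_fset (B k)) = (mdist 1%g x <= k%:R).
  rewrite (_ : _ \in _ = (x \in [set y : G | mdist 1%g y <= k%:R])) ?in_setE//=; last first.
    by rewrite -in_fset_set//; exact: G_proper.
  by apply/idP/idP; rewrite inE.
have BF k x : mdist 1%g x <= k%:R -> F k x.
  by move=> xk; apply: sub_gen_smallest; rewrite /= BP.
have Fc k : group_closed (mem (F k)).
  split=> [|x y]; first by rewrite inE => A [[A1 _] _]; move: A1; rewrite inE.
  rewrite !inE => Fx Fy A AB; have [[_ Ac] _] := AB.
  by have := Ac x y; rewrite !inE; apply; [exact: Fx|exact: Fy].
have Fld k : left_difference_closed (F k).
  have [F1 _] := Fc k; split=> [|x y Fx Fy]; first by move: F1; rewrite inE.
  have := group_closedM (Fc k) (x := (x^-1)%g) (y := y).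
  rewrite !inE; apply => //.
  by have := group_closedV (Fc k) (x := x); rewrite !inE; exact.
have Fs k : F k `<=` F k.+1.
  apply: sub_smallest2r; first exact: Fc.
  by move=> x /=; rewrite !BP => /le_trans; apply; rewrite ler_nat.
have bound (r : R) : exists k : nat, r <= k%:R.
  by exists (Num.bound `|r|); apply: le_trans (ler_norm r) (ltW (archi_boundP (normr_ge0 r))).
have Fa x : exists k, F k x.
  by have [k kx] := bound (mdist 1%g x); exists k; exact: BF.
have [size_ [rank [elt [s0 sd rK rlt [eK cosets]]]]] :=
  group_chain_ranking Fld Fs (fun k => G_locally_finite _) Fa.
have dist1 (x y : G) : mdist x y = mdist (1%g : G) (x^-1 * y)%g.
  by rewrite -(G_left_invariant x 1%g) mulg1 mulVKg.
exists size_, rank, elt; split=> // [k|r].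
  pose L := finmap.enum_fset (fset_set (F k)).
  exists (\sum_(z <- L) mdist 1%g z) => x y /cosets Fxy.
  have zL : (x^-1 * y)%g \in L.
    rewrite (_ : _ \in L = ((x^-1 * y)%g \in F k)) ?inE//.
    by rewrite -in_fset_set//; exact: G_locally_finite.
  rewrite dist1 (big_rem _ zL)/= lerDl.
  by apply: sumr_ge0 => z _; exact: mdist_ge0.
have [k rk] := bound r; exists k => x y xy.
apply: (iffLR (cosets k x y)); apply: BF; rewrite -dist1; exact: le_trans rk.
Qed.

End MetricGroup.

Theorem theoremG (R : realType) (Gamma Lambda : metricGroupType R)
  (Gamma_countable : countable [set: Gamma])
  (Lambda_countable : countable [set: Lambda])
  (Gamma_locally_finite : locally_finite Gamma)
  (Lambda_locally_finite : locally_finite Lambda)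
  (Gamma_proper : proper_metric Gamma)
  (Lambda_proper : proper_metric Lambda)
  (Gamma_left_invariant : left_invariant Gamma)
  (Lambda_left_invariant : left_invariant Lambda) :
  [<-> bijectively_coarsely_equivalent Gamma Lambda ;
       forall p : exponent R,
         exists2 phi : roe p Gamma -> roe p Lambda,
           isometric_isomorphism phi &
           phi @` ell_infty p Gamma = ell_infty p Lambda ;
       exists (p : exponent R) (phi : roe p Gamma -> roe p Lambda),
         isometric_isomorphism phi ;
       forall p : exponent R, K0_triple_iso (roe p Gamma) (roe p Lambda) ;
       exists p : exponent R, K0_pair_iso (roe p Gamma) (roe p Lambda) ].
Proof.
have [n_ [rG [eG tG]]] := group_tower Gamma_locally_finite Gamma_proper Gamma_left_invariant.
have [m_ [rL [eL tL]]] := group_tower Lambda_locally_finite Lambda_proper Lambda_left_invariant.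
have iso_K0 p (phi : roe p Gamma -> roe p Lambda) : isometric_isomorphism phi ->
    K0_triple_iso (roe p Gamma) (roe p Lambda).
  case=> bphi lphi mphi _; apply: ring_isomorphism_K0_triple_iso bphi _ mphi.
  by move=> S T; rewrite -[S - T]addrC -scaleN1r lphi scaleN1r addrC.
have pair p : K0_triple_iso (roe p Gamma) (roe p Lambda) ->
    K0_pair_iso (roe p Gamma) (roe p Lambda).
  by case=> h [hb _ h1]; exists h.
have coarse p : K0_pair_iso (roe p Gamma) (roe p Lambda) ->
    bijectively_coarsely_equivalent Gamma Lambda.
  case=> h [[g hK gK] h1].
  apply: (tower_coarse_equivalent tG tL) => k.
    have [x xE] := tower_divides p tG (dvdnn (n_ k)).
    by apply: (tower_divisor tL (x := h x)); rewrite -h1 xE raddfMn.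
  have [x xE] := tower_divides p tL (dvdnn (m_ k)).
  apply: (tower_divisor tG (x := g x)).
  by apply: (can_inj hK); rewrite h1 raddfMn gK.
have p1 : exponent R by exists 1.
tfae.
- by move=> XY p; exact: coarse_bijection_isometric_isomorphism.
- by move=> /(_ p1)[phi phiP _]; exists p1, phi.
- move=> [q [phi phiP]] p.
  (* the coarse equivalence links the exponents q and p *)
  have XY := coarse q (pair q (iso_K0 q phi phiP)).
  have [psi psiP _] := coarse_bijection_isometric_isomorphism p XY.
  exact: iso_K0 psiP.
- by move=> /(_ p1)/pair; exists p1.
- by move=> [p /coarse].
Qed.
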